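(* Let $R$ be a ring with identity and let $X$ be a chain complex of $R$-modules. Then $X$ is a Gorenstein AC-injective chain complex if and only if each $X_n$ is a Gorenstein AC-injective $R$-module and the complex of abelian groups $\mathit{Hom}(A,X)$ is exact for every absolutely clean chain complex $A$. Equivalently, $X$ is Gorenstein AC-injective if and only if each $X_n$ is a Gorenstein AC-injective $R$-module and every chain map $f : A \to X$ is null homotopic whenever $A$ is an absolutely clean chain complex.
   Context: $R$-modules are left $R$-modules; $\mathrm{Ch}(R)$ is the category of ($\mathbb{Z}$-graded, unbounded) chain complexes of $R$-modules, with differentials lowering degree. A chain complex is finitely generated if it is bounded and finitely generated in each degree. Injective complexes are the injective objects of $\mathrm{Ch}(R)$. For chain complexes $X,Y$, $\mathit{Hom}(X,Y)$ is the complex of abelian groups with $\mathit{Hom}(X,Y)_n = \prod_{k\in\mathbb{Z}} \mathrm{Hom}_R(X_k,Y_{k+n})$ and differential $(\delta_n f)_k = d_{k+n}f_k - (-1)^n f_{k-1}d_k$. An $R$-module $M$ (resp. chain complex $X$) is of type $FP_\infty$ if it has a projective resolution by finitely generated projective modules (resp. finitely generated projective objects of $\mathrm{Ch}(R)$). An $R$-module $N$ is absolutely clean if $\mathrm{Ext}^1_R(M,N)=0$ for all $R$-modules $M$ of type $FP_\infty$. A chain complex $A$ is absolutely clean if $\mathrm{Ext}^1_{\mathrm{Ch}(R)}(X,A)=0$ for all chain complexes $X$ of type $FP_\infty$. An $R$-module $N$ is Gorenstein AC-injective if there is an exact complex of injective $R$-modules $\cdots \to I_1 \to I_0 \to I^0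 \to I^1 \to \cdots$ with $N = \ker(I^0 \to I^1)$ which remains exact after applying $\mathrm{Hom}_R(A,-)$ for every absolutely clean $R$-module $A$. A chain complex $X$ is Gorenstein AC-injective if there is an exact complex of injective complexes $\cdots \to I_1 \to I_0 \to I^0 \to I^1 \to \cdots$ with $X = \ker(I^0 \to I^1)$ which remains exact after applying $\mathrm{Hom}_{\mathrm{Ch}(R)}(A,-)$ (the abelian group of chain maps) for every absolutely clean chain complex $A$. *)

(* Defs.v *)
From HB Require Import structures.
From mathcomp Require Import all_boot all_order all_algebra zify.

Set Implicit Arguments.
Unset Strict Implicit.
Unset Printing Implicit Defensive.

Import GRing.Theory.
Local Open Scope ring_scope.

(* Everything is stated for an arbitrary (possibly zero) unital ring
   R : pzRingType and left modules lmodType R.  Two maps are compared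
   pointwise, so that no axiom is needed here. *)

Definition surj (A B : Type) (f : A -> B) : Prop := forall y, exists x, f x = y.

(* ker g = im f *)
Definition exact_at (A B : Type) (C : zmodType) (f : A -> B) (g : B -> C) : Prop :=
  forall y, g y = 0 <-> exists x, f x = y.

Record chain_complex (R : pzRingType) := ChainComplex {
  cc_obj :> int -> lmodType R;
  cc_d : forall n : int, {linear cc_obj n -> cc_obj (n - 1)};
  cc_dd : forall (n : int) (x : cc_obj n), cc_d (n - 1) (cc_d n x) = 0
}.

Record chain_map (R : pzRingType) (X Y : chain_complex R) := ChainMap {
  cm_fun :> forall n : int, {linear X n -> Y n};
  cm_comm : forall (n : int) (x : X n),
    cm_fun (n - 1) (cc_d X n x) = cc_d Y n (cm_fun n x)
}.

(* Exactness at every degree.  Here and below the degree at which a condition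
   is expressed is often called n - 1 instead of n: as n ranges over all the
   integers this changes nothing, and it makes the types of d_n and d_(n-1)
   match without any transport. *)
Definition complex_exact (R : pzRingType) (X : chain_complex R) : Prop :=
  forall n : int, exact_at (cc_d X n) (cc_d X (n - 1)).

Section Modules.
Variable R : pzRingType.

Definition fg_module (M : lmodType R) : Prop :=
  exists (n : nat) (g : 'I_n -> M),
    forall x : M, exists a : 'I_n -> R, x = \sum_(i < n) a i *: g i.

Definition projective_module (P : lmodType R) : Prop :=
  forall (U V : lmodType R) (p : {linear U -> V}) (f : {linear P -> V}),
    surj p -> exists g : {linear P -> U}, forall x, p (g x) = f x.

Definition injective_module (I : lmodType R) : Prop :=
  forall (U V : lmodType R) (i : {linear U -> V}) (f : {linear U -> I}),
    injective i -> exists g : {linear V -> I}, forall x, g (i x) = f x.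

Definition FPinf_module (M : lmodType R) : Prop :=
  exists (P : nat -> lmodType R) (d : forall n, {linear P n.+1 -> P n})
         (e : {linear P 0%N -> M}),
    [/\ forall n, fg_module (P n) /\ projective_module (P n),
        surj e,
        exact_at (d 0%N) e
      & forall n, exact_at (d n.+1) (d n)].

(* Ext^1(M, N) is the Yoneda group of equivalence classes of extensions
   0 -> N -> E -> M -> 0, whose zero is the class of the split extension. *)
Record mod_extension (M N : lmodType R) := ModExtension {
  me_mid : lmodType R;
  me_inj : {linear N -> me_mid};
  me_proj : {linear me_mid -> M};
  me_injP : injective me_inj;
  me_projP : surj me_proj;
  me_exact : exact_at me_inj me_proj
}.

Definition mod_ext_equiv (M N : lmodType R) (E F : mod_extension M N) : Prop :=
  exists h : {linear me_mid E -> me_mid F},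
    (forall y, h (me_inj E y) = me_inj F y) /\
    (forall x, me_proj F (h x) = me_proj E x).

Definition pair_inl (M N : lmodType R) (y : N) : (N * M)%type := (y, 0).

Fact pair_inl_is_linear (M N : lmodType R) : linear (@pair_inl M N).
Proof. by move=> a x y; congr (_, _); rewrite /= scaler0 addr0. Qed.

HB.instance Definition _ (M N : lmodType R) :=
  GRing.isLinear.Build R N (N * M)%type _ (@pair_inl M N) (@pair_inl_is_linear M N).

Fact pair_inl_inj (M N : lmodType R) : injective (@pair_inl M N).
Proof. by move=> x y []. Qed.

Fact pair_snd_surj (M N : lmodType R) : surj (@snd N M).
Proof. by move=> x; exists (0, x). Qed.

Fact pair_exact (M N : lmodType R) : exact_at (@pair_inl M N) (@snd N M).
Proof. by move=> [y x] /=; split=> [->|[z [_ <-]]] //; exists y. Qed.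

Definition split_mod_ext (M N : lmodType R) : mod_extension M N :=
  @ModExtension M N (N * M)%type (@pair_inl M N) (@snd N M)
    (@pair_inl_inj M N) (@pair_snd_surj M N) (@pair_exact M N).

Definition mod_Ext1_eq0 (M N : lmodType R) : Prop :=
  forall E : mod_extension M N, mod_ext_equiv E (split_mod_ext M N).

Definition abs_clean_module (N : lmodType R) : Prop :=
  forall M : lmodType R, FPinf_module M -> mod_Ext1_eq0 M N.

(* The two-sided sequence ... -> I_1 -> I_0 -> I^0 -> I^1 -> ... is a chain
   complex I with I^k in degree - k and I_k in degree k + 1, so that N is
   identified (via the injective map i) with the kernel of I 0 -> I (0 - 1). *)
Definition GAC_injective_module (N : lmodType R) : Prop :=
  exists I : chain_complex R,
    [/\ forall n, injective_module (I n),
        complex_exact I,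
        exists i : {linear N -> I 0}, injective i /\ exact_at i (cc_d I 0)
      & forall A : lmodType R, abs_clean_module A ->
        forall (n : int) (g : {linear A -> I (n - 1)}),
          (forall a, cc_d I (n - 1) (g a) = 0) <->
          exists h : {linear A -> I n}, forall a, cc_d I n (h a) = g a].

End Modules.

Section Complexes.
Variable R : pzRingType.
Implicit Types X Y Z A : chain_complex R.

Definition cm_injective X Y (f : chain_map X Y) : Prop :=
  forall n, injective (f n).

Definition cm_surjective X Y (f : chain_map X Y) : Prop :=
  forall n, surj (f n).

Definition cm_exact_at X Y Z (f : chain_map X Y) (g : chain_map Y Z) : Prop :=
  forall n, exact_at (f n) (g n).

Definition bounded_complex X : Prop :=
  exists a b : int, forall n : int, (n < a) || (b < n) -> forall x : X n, x = 0.

Definition fg_complex X : Prop :=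
  bounded_complex X /\ forall n, fg_module (X n).

Definition projective_complex (P : chain_complex R) : Prop :=
  forall X Y (p : chain_map X Y) (f : chain_map P Y),
    cm_surjective p ->
    exists g : chain_map P X, forall n x, p n (g n x) = f n x.

Definition injective_complex (I : chain_complex R) : Prop :=
  forall X Y (i : chain_map X Y) (f : chain_map X I),
    cm_injective i ->
    exists g : chain_map Y I, forall n x, g n (i n x) = f n x.

Definition FPinf_complex X : Prop :=
  exists (P : nat -> chain_complex R) (d : forall m, chain_map (P m.+1) (P m))
         (e : chain_map (P 0%N) X),
    [/\ forall m, fg_complex (P m) /\ projective_complex (P m),
        cm_surjective e,
        cm_exact_at (d 0%N) e
      & forall m, cm_exact_at (d m.+1) (d m)].

Record cx_extension X Y := CxExtension {
  ce_mid : chain_complex R;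
  ce_inj : chain_map Y ce_mid;
  ce_proj : chain_map ce_mid X;
  ce_injP : cm_injective ce_inj;
  ce_projP : cm_surjective ce_proj;
  ce_exact : cm_exact_at ce_inj ce_proj
}.

Definition cx_ext_equiv X Y (E F : cx_extension X Y) : Prop :=
  exists h : chain_map (ce_mid E) (ce_mid F),
    (forall n y, h n (ce_inj E n y) = ce_inj F n y) /\
    (forall n x, ce_proj F n (h n x) = ce_proj E n x).

Section DirectSum.
Variables Y X : chain_complex R.

Definition dsum_obj (n : int) : lmodType R := (Y n * X n)%type.

Definition dsum_d (n : int) (z : dsum_obj n) : dsum_obj (n - 1) :=
  (cc_d Y n z.1, cc_d X n z.2).

Fact dsum_d_is_linear n : linear (@dsum_d n).
Proof. by move=> a x y; congr (_, _); rewrite /= linearP. Qed.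

HB.instance Definition _ n :=
  GRing.isLinear.Build R (dsum_obj n) (dsum_obj (n - 1)) _ (@dsum_d n)
    (@dsum_d_is_linear n).

Fact dsum_dd n (z : dsum_obj n) : dsum_d (dsum_d z) = 0.
Proof. by rewrite /dsum_d /= !cc_dd. Qed.

Definition dsum_complex : chain_complex R :=
  @ChainComplex R dsum_obj (fun n => @dsum_d n) dsum_dd.

Fact dsum_inl_comm n (y : Y n) :
  pair_inl (X (n - 1)) (cc_d Y n y) = cc_d dsum_complex n (pair_inl (X n) y).
Proof. by congr (_, _); rewrite /= linear0. Qed.

Definition dsum_inl : chain_map Y dsum_complex :=
  @ChainMap R Y dsum_complex (fun n => @pair_inl R (X n) (Y n)) dsum_inl_comm.

Definition dsum_snd : chain_map dsum_complex X :=
  @ChainMap R dsum_complex X (fun n => @snd (Y n) (X n)) (fun n z => erefl).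

End DirectSum.

Definition split_cx_ext X Y : cx_extension X Y :=
  @CxExtension X Y (dsum_complex Y X) (dsum_inl Y X) (dsum_snd Y X)
    (fun n => @pair_inl_inj R (X n) (Y n))
    (fun n => @pair_snd_surj R (X n) (Y n))
    (fun n => @pair_exact R (X n) (Y n)).

Definition cx_Ext1_eq0 X Y : Prop :=
  forall E : cx_extension X Y, cx_ext_equiv E (split_cx_ext X Y).

Definition abs_clean_complex A : Prop :=
  forall X, FPinf_complex X -> cx_Ext1_eq0 X A.

(* Same indexing as for modules: I^k is I (- k) and I_k is I (k + 1). *)
Definition GAC_injective_complex X : Prop :=
  exists (I : int -> chain_complex R) (d : forall m, chain_map (I m) (I (m - 1))),
    [/\ forall m, injective_complex (I m),
        forall m, cm_exact_at (d m) (d (m - 1)),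
        exists i : chain_map X (I 0), cm_injective i /\ cm_exact_at i (d 0)
      & forall A, abs_clean_complex A ->
        forall (m : int) (g : chain_map A (I (m - 1))),
          (forall n a, d (m - 1) n (g n a) = 0) <->
          exists h : chain_map A (I m), forall n a, d m n (h n a) = g n a].

(* A null homotopy is a family s_n : X_(n-1) -> Y_n with
   f_(n-1) = d_n s_n + s_(n-1) d_(n-1). *)
Definition null_homotopic X Y (f : chain_map X Y) : Prop :=
  exists s : forall n : int, {linear X (n - 1) -> Y n},
    forall (n : int) (x : X (n - 1)),
      f (n - 1) x = cc_d Y n (s n x) + s (n - 1) (cc_d X (n - 1) x).

End Complexes.

Section HomComplex.
Variable R : pzRingType.

(* Transport along an equality of degrees. *)
Definition deg_cast (Y : int -> lmodType R) (m n : int) (e : m = n) (y : Y m) : Y n :=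
  ecast i (Y i) e y.

Fact deg_cast_is_linear (Y : int -> lmodType R) m n (e : m = n) :
  linear (@deg_cast Y m n e).
Proof. by case: n / e. Qed.

HB.instance Definition _ (Y : int -> lmodType R) m n (e : m = n) :=
  GRing.isLinear.Build R (Y m) (Y n) _ (@deg_cast Y m n e)
    (@deg_cast_is_linear Y m n e).

Variables X Y : chain_complex R.

(* Hom(X, Y)_n = prod_k Hom_R(X_k, Y_(k+n)) *)
Definition hom_obj (n : int) : Type := forall k : int, {linear X k -> Y (k + n)}.

(* (delta_n f)_k = d_(k+n) f_k - (-1)^n f_(k-1) d_k, where the two terms, in
   Y_((k+n)-1) and Y_((k-1)+n), are transported to Y_(k+(n-1)). *)
Definition hom_d_fun (n : int) (f : hom_obj n) (k : int) (x : X k) : Y (k + (n - 1)) :=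
  deg_cast (esym (addrA k n (- 1))) (cc_d Y (k + n) (f k x))
  - (-1) ^+ `|n|%N *:
      deg_cast (etrans (addrAC k (- 1) n) (esym (addrA k n (- 1))))
               (f (k - 1) (cc_d X k x)).

Fact hom_d_is_linear n (f : hom_obj n) k : linear (@hom_d_fun n f k).
Proof.
move=> a x y; rewrite /hom_d_fun !linearP scalerDr scalerA -commr_sign -scalerA.
by rewrite scalerBr opprD addrACA.
Qed.

HB.instance Definition _ n (f : hom_obj n) k :=
  GRing.isLinear.Build R (X k) (Y (k + (n - 1))) _ (@hom_d_fun n f k)
    (@hom_d_is_linear n f k).

Definition hom_d (n : int) (f : hom_obj n) : hom_obj (n - 1) :=
  fun k => @hom_d_fun n f k.

Fact deg_castK (Z : int -> lmodType R) m n p (e : m = n) (e' : n = p) (e'' : m = p) (y : Z m) :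
  deg_cast e' (deg_cast e y) = deg_cast e'' y.
Proof. by case: p / e' e''; case: n / e => e''; rewrite (eq_irrelevance e'' erefl). Qed.

Fact cc_d_cast m n (e : m = n) (e' : m - 1 = n - 1) (y : Y m) :
  cc_d Y n (deg_cast e y) = deg_cast e' (cc_d Y m y).
Proof. by case: n / e e' => e'; rewrite (eq_irrelevance e' erefl). Qed.

Fact sign_pred (n : int) : (-1) ^+ `|(n - 1)%R|%N = - (-1) ^+ `|n|%N :> R.
Proof.
rewrite -signr_odd -[in RHS]signr_odd.
have -> : odd `|(n - 1)%R|%N = ~~ odd `|n|%N by lia.
by case: odd; rewrite /= ?expr0 ?expr1 ?opprK.
Qed.

Fact hom_dd n (f : hom_obj n) k (x : X k) : hom_d (hom_d f) k x = 0.
Proof.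
rewrite /hom_d /= /hom_d_fun /= /hom_d_fun /= cc_dd !linear0 scaler0 subr0 sign_pred scaleNr opprK.
have e1 : k + n - 1 - 1 = k + (n - 1) - 1 by lia.
have e2 : k - 1 + n - 1 = k + (n - 1) - 1 by lia.
have e3 : k - 1 + n - 1 = k + (n - 1 - 1) by lia.
rewrite linearB linearZ_LR /= (cc_d_cast _ e1) cc_dd !linear0 sub0r.
rewrite linearN linearZ_LR /=.
rewrite (cc_d_cast _ e2) !(deg_castK _ _ e3).
by rewrite addNr.
Qed.

Definition hom_complex_exact : Prop :=
  forall (n : int) (f : hom_obj (n - 1)),
    (forall k x, hom_d f k x = 0) <->
    exists g : hom_obj n, forall k x, hom_d g k x = f k x.

End HomComplex.

(* Main.v *)
Require Import Defs.
From HB Require Import structures.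
From Stdlib Require Import ClassicalEpsilon.
From mathcomp Require Import all_boot all_order all_algebra zify.

(* A null homotopy of f : A -> X is the same as an extension of f along the
   embedding of A into the contractible complex [cone A], whose cokernel is the
   suspension of A.  If X is Gorenstein AC-injective, with X in I^0, such an
   extension exists: extend A -> X -> I^0 to [cone A], and correct the result by
   a lift to I^0 of the induced map from the (absolutely clean) suspension of A
   to I^1.  Testing on discs shows that each X_n is Gorenstein AC-injective.

   Conversely, let W ([ac_good]) be the class of complexes Y with all Y_n
   Gorenstein AC-injective and all maps from absolutely clean complexes null
   homotopic.  For Y in W there are short exact sequences 0 -> Y -> I -> Y' -> 0
   and 0 -> Y'' -> I' -> Y -> 0 with I, I' injective (products of discs on
   injective modules) and Y', Y'' in W: degreewise, Y' and Y'' are the products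
   of a (co)syzygy of Y_n and an injective module.  Splicing these sequences
   gives the complete resolution, because a null homotopic map A -> Y factors
   through [cone A], whose maps can be lifted degree by degree. *)

Set Implicit Arguments.
Unset Strict Implicit.
Unset Printing Implicit Defensive.

Import GRing.Theory.
Local Open Scope ring_scope.

(** * Choice and a change of degree *)

(** Turns degreewise existence statements into graded families of maps; it rests on classical
    indefinite description. *)
Lemma dep_choice (I : Type) (T : I -> Type) (P : forall i, T i -> Prop) :
  (forall i, exists x, P i x) -> exists f : forall i, T i, forall i, P i (f i).
Proof.
move=> h; exists (fun i => proj1_sig (constructive_indefinite_description _ (h i))).
by move=> i; case: constructive_indefinite_description.
Qed.

(** Allows a degree to be renamed [k - 1], so that the differential leaving degree [k] lands in it
    without transport. *)
Lemma int_pred_surj (P : int -> Prop) : (forall k, P (k - 1)) -> forall k, P k.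
Proof. by move=> h k; have := h (k + 1); rewrite addrK. Qed.

(** * Linear maps, kernels and cokernels *)

Section LinearMaps.
Variable R : pzRingType.

Definition mklin (U V : lmodType R) (f : U -> V) (lf : linear f) : {linear U -> V} :=
  HB.pack f (GRing.isLinear.Build R U V *:%R f lf).

(** Chosen preimages under [j] are unique, which forces the choice function to be linear. *)
Lemma linear_lift_inj (U V W : lmodType R) (j : {linear U -> V}) (f : {linear W -> V}) :
  injective j -> (forall w, exists u, j u = f w) ->
  exists g : {linear W -> U}, forall w, j (g w) = f w.
Proof.
move=> ij /dep_choice[g hg].
have lg : linear g by move=> a x y; apply: ij; rewrite linearP !hg linearP.
by exists (mklin lg).
Qed.

(** Compose [f] with a set-theoretic section of [p]; the result is independent of the section, hence
    linear, because [f] kills the kernel of [p]. *)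
Lemma linear_factor_surj (U V W : lmodType R) (p : {linear U -> V}) (f : {linear U -> W}) :
  surj p -> (forall u, p u = 0 -> f u = 0) ->
  exists g : {linear V -> W}, forall u, g (p u) = f u.
Proof.
move=> /dep_choice[s hs] hf.
have fs u u' : p u = p u' -> f u = f u'.
  by move=> e; apply/eqP; rewrite -subr_eq0 -linearB hf // linearB e subrr.
have lg : linear (f \o s).
  by move=> a x y /=; rewrite -linearP; apply: fs; rewrite linearP !hs.
by exists (mklin lg) => u /=; apply: fs; rewrite hs.
Qed.

Lemma inj_ker0 (U V : lmodType R) (f : {linear U -> V}) :
  (forall x, f x = 0 -> x = 0) -> injective f.
Proof.
by move=> h x y e; apply/eqP; rewrite -subr_eq0; apply/eqP/h; rewrite linearB e subrr.
Qed.

Section Kernel.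
Variables (U V : lmodType R) (f : {linear U -> V}).

Definition lker_pred : pred U := fun x => f x == 0.

Fact lker_pred_submod : submod_closed lker_pred.
Proof.
split=> [|a x y]; rewrite !unfold_in ?linear0 // => /eqP fx /eqP fy.
by rewrite linearP fx fy scaler0 addr0.
Qed.

HB.instance Definition _ := GRing.isSubmodClosed.Build R U lker_pred lker_pred_submod.

Record lkernel := LKernel { lker_val : U; _ : lker_pred lker_val }.
HB.instance Definition _ := [isSub for lker_val].
HB.instance Definition _ := [Choice of lkernel by <:].
HB.instance Definition _ := [SubChoice_isSubLmodule of lkernel by <:].

Lemma lker_val_inj : injective lker_val.
Proof. exact: val_inj. Qed.

Lemma lker_val_exact : exact_at lker_val f.
Proof. by move=> x; split=> [/eqP fx|[[y ys] <-]]; [exists (LKernel fx)|exact/eqP]. Qed.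

Fact lker_val_linear : linear lker_val.
Proof. by []. Qed.

End Kernel.

Lemma ker_linear_exists (U V : lmodType R) (f : {linear U -> V}) :
  exists (K : lmodType R) (i : {linear K -> U}), injective i /\ exact_at i f.
Proof.
exists (lkernel f), (mklin (@lker_val_linear _ _ f)).
by split; [exact: lker_val_inj|exact: lker_val_exact].
Qed.

Section Cokernel.
Local Open Scope quotient_scope.
Variables (U V : lmodType R) (f : {linear U -> V}).

(** The quotient construction takes a boolean predicate, so membership in the image is decided by
    excluded middle. *)
Definition lim_pred : pred V :=
  fun y => if excluded_middle_informative (exists x, f x = y) then true else false.

Lemma lim_predP y : reflect (exists x, f x = y) (lim_pred y).
Proof. by rewrite /lim_pred; case: excluded_middle_informative => h; constructor. Qed.

Fact lim_pred_submod : submod_closed lim_pred.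
Proof.
split=> [|a x y]; first by apply/lim_predP; exists 0; rewrite linear0.
by case/lim_predP=> u <- /lim_predP[v <-]; apply/lim_predP; exists (a *: u + v); rewrite linearP.
Qed.

HB.instance Definition _ := GRing.isSubmodClosed.Build R V lim_pred lim_pred_submod.

Definition lcoker := Quotient.quot (GRing.ZmodClosed.clone V lim_pred _).
HB.instance Definition _ := GRing.Zmodule.on lcoker.
HB.instance Definition _ := EqQuotient.on lcoker.

Definition lcoker_pi (x : V) : lcoker := \pi_lcoker x.

Lemma lcoker_piP x y : lcoker_pi x = lcoker_pi y <-> exists u, f u = x - y.
Proof.
split=> [/eqP|/lim_predP h]; last by apply/eqP; rewrite -Quotient.idealrBE.
by rewrite -Quotient.idealrBE => /lim_predP.
Qed.

(** The quotient by [lim_pred] carries only a group structure; scalars act through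
    representatives. *)
Definition lcoker_scale (a : R) (x : lcoker) : lcoker := lcoker_pi (a *: repr x).

Lemma lcoker_piD x y : lcoker_pi (x + y) = lcoker_pi x + lcoker_pi y.
Proof. exact: raddfD. Qed.

(** Independence of the representative: two of them differ by an element of the image, which is
    stable under scaling. The module axioms then descend from [V]. *)
Lemma lcoker_piZ a x : lcoker_pi (a *: x) = lcoker_scale a (lcoker_pi x).
Proof.
apply/lcoker_piP; have [|u hu] := (lcoker_piP x (repr (lcoker_pi x))).1.
  exact/esym/reprK.
by exists (a *: u); rewrite linearZ_LR hu scalerBr.
Qed.

Lemma lcoker_pi_surj : surj lcoker_pi.
Proof. by move=> x; exists (repr x); exact: reprK. Qed.

Fact lcoker_scaleA a b x : lcoker_scale a (lcoker_scale b x) = lcoker_scale (a * b) x.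
Proof. by case: (lcoker_pi_surj x) => y <-; rewrite -!lcoker_piZ scalerA. Qed.

Fact lcoker_scale1 x : lcoker_scale 1 x = x.
Proof. by case: (lcoker_pi_surj x) => y <-; rewrite -!lcoker_piZ scale1r. Qed.

Fact lcoker_scaleDr : right_distributive lcoker_scale +%R.
Proof.
move=> a x y; case: (lcoker_pi_surj x) (lcoker_pi_surj y) => x' <- [y' <-].
by rewrite -lcoker_piD -!lcoker_piZ scalerDr lcoker_piD.
Qed.

Fact lcoker_scaleDl x : {morph lcoker_scale^~ x : a b / a + b}.
Proof.
move=> a b; case: (lcoker_pi_surj x) => y <-.
by rewrite -!lcoker_piZ scalerDl lcoker_piD.
Qed.

HB.instance Definition _ := GRing.Zmodule_isLmodule.Build R lcoker
  lcoker_scaleA lcoker_scale1 lcoker_scaleDr lcoker_scaleDl.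

Fact lcoker_pi_linear : linear lcoker_pi.
Proof. by move=> a x y; rewrite lcoker_piD lcoker_piZ. Qed.

Lemma lcoker_pi_exact : exact_at f lcoker_pi.
Proof.
move=> x; have e0 : lcoker_pi 0 = 0 by exact: raddf0.
by rewrite -e0 lcoker_piP subr0.
Qed.

End Cokernel.

Lemma coker_linear_exists (U V : lmodType R) (f : {linear U -> V}) :
  exists (W : lmodType R) (p : {linear V -> W}), surj p /\ exact_at f p.
Proof.
exists (lcoker f), (mklin (@lcoker_pi_linear _ _ f)).
by split; [exact: lcoker_pi_surj|exact: lcoker_pi_exact].
Qed.

End LinearMaps.

(** * Chain maps, subcomplexes and quotient complexes *)

Section ChainMaps.
Variable R : pzRingType.
Implicit Types X Y Z A : chain_complex R.

Definition cm_id X : chain_map X X :=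
  @ChainMap R X X (fun n => idfun) (fun n x => erefl).

Definition cm_comp X Y Z (g : chain_map Y Z) (f : chain_map X Y) : chain_map X Z.
Proof.
exists (fun n => g n \o f n : {linear X n -> Z n}).
by move=> n x /=; rewrite !cm_comm.
Defined.

Definition cm_sub X Y (f g : chain_map X Y) : chain_map X Y.
Proof.
exists (fun n => f n \- g n : {linear X n -> Y n}).
by move=> n x /=; rewrite !cm_comm linearB.
Defined.

(** The degreewise lifts commute with the differentials because this can be checked after applying
    the injective [j]. *)
Lemma cm_lift_inj X Y Z (j : chain_map X Y) (f : chain_map Z Y) :
  cm_injective j -> (forall n z, exists x, j n x = f n z) ->
  exists g : chain_map Z X, forall n z, j n (g n z) = f n z.
Proof.
move=> ij hf.
have /dep_choice[g hg] n : exists g : {linear Z n -> X n}, forall z, j n (g z) = f n z.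
  exact: linear_lift_inj (ij n) (hf n).
have cg n z : g (n - 1) (cc_d Z n z) = cc_d X n (g n z).
  by apply: ij; rewrite cm_comm !hg cm_comm.
by exists (ChainMap cg).
Qed.

Lemma cm_factor_surj X Y Z (p : chain_map X Y) (f : chain_map X Z) :
  cm_surjective p -> (forall n x, p n x = 0 -> f n x = 0) ->
  exists g : chain_map Y Z, forall n x, g n (p n x) = f n x.
Proof.
move=> sp hf.
have /dep_choice[g hg] n : exists g : {linear Y n -> Z n}, forall x, g (p n x) = f n x.
  exact: linear_factor_surj (sp n) (hf n).
have cg n y : g (n - 1) (cc_d Y n y) = cc_d Z n (g n y).
  by case: (sp n y) => x <-; rewrite -cm_comm !hg cm_comm.
by exists (ChainMap cg).
Qed.

(** The differential is returned apart from the complex so that the modules of the latter are the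
    given [K n] by definition; properties of [K n] then apply directly. *)
Lemma subcomplex_exists (K : int -> lmodType R) Y (j : forall n, {linear K n -> Y n}) :
  (forall n, injective (j n)) ->
  (forall n x, exists x', j (n - 1) x' = cc_d Y n (j n x)) ->
  exists (dK : forall n, {linear K n -> K (n - 1)})
    (ddK : forall n x, dK (n - 1) (dK n x) = 0)
    (jc : chain_map (ChainComplex ddK) Y), forall n x, jc n x = j n x.
Proof.
move=> ij hj.
have /dep_choice[dK hd] n : exists dK : {linear K n -> K (n - 1)},
    forall x, j (n - 1) (dK x) = cc_d Y n (j n x).
  exact: (linear_lift_inj (f := cc_d Y n \o j n) (ij _) (hj n)).
have ddK n x : dK (n - 1) (dK n x) = 0.
  by apply: ij; rewrite !hd cc_dd linear0.
exists dK, ddK; exists (@ChainMap R (ChainComplex ddK) Y j hd).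
by [].
Qed.

Lemma quotient_complex_exists (Q : int -> lmodType R) X (p : forall n, {linear X n -> Q n}) :
  (forall n, surj (p n)) ->
  (forall n x, p n x = 0 -> p (n - 1) (cc_d X n x) = 0) ->
  exists (dQ : forall n, {linear Q n -> Q (n - 1)})
    (ddQ : forall n x, dQ (n - 1) (dQ n x) = 0)
    (pc : chain_map X (ChainComplex ddQ)), forall n x, pc n x = p n x.
Proof.
move=> sp hp.
have /dep_choice[dQ hd] n : exists dQ : {linear Q n -> Q (n - 1)},
    forall x, dQ (p n x) = p (n - 1) (cc_d X n x).
  exact: (linear_factor_surj (f := p (n - 1) \o cc_d X n) (sp n) (hp n)).
have ddQ n y : dQ (n - 1) (dQ n y) = 0.
  by case: (sp n y) => x <-; rewrite !hd cc_dd linear0.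
exists dQ, ddQ.
by exists (@ChainMap R X (ChainComplex ddQ) p (fun n x => esym (hd n x))).
Qed.

Lemma cm_exact_comp0 X Y Z (f : chain_map X Y) (g : chain_map Y Z) :
  cm_exact_at f g -> forall n x, g n (f n x) = 0.
Proof. by move=> e n x; apply/(e n); exists x. Qed.

End ChainMaps.

(** * Contractible complexes and their mapping properties *)

(* [cone B] is contractible.  For a complex A, [cone A] is the mapping cone of
   the identity of A, shifted so that A embeds in it through
   [cone_unit : x |-> (d x, x)]; for B concentrated in degree n - 1 it is the
   disc D^n(B). *)
Section Cone.
Variable R : pzRingType.
Implicit Types (B : int -> lmodType R) (X Y A : chain_complex R).

Definition cone_obj B (k : int) : lmodType R := (B (k - 1) * B k)%type.

Definition cone_d_fun B k (x : cone_obj B k) : cone_obj B (k - 1) := (0, x.1).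

Fact cone_d_linear B k : linear (@cone_d_fun B k).
Proof. by move=> a x y; congr (_, _); rewrite /= scaler0 addr0. Qed.

Definition cone_d B k : {linear cone_obj B k -> cone_obj B (k - 1)} :=
  mklin (@cone_d_linear B k).

Fact cone_dd B k x : cone_d B (k - 1) (cone_d B k x) = 0.
Proof. by []. Qed.

Definition cone B : chain_complex R := ChainComplex (@cone_dd B).

Lemma cone_dE B k (t : B (k - 1)) (b : B k) : cc_d (cone B) k (t, b) = (0, t).
Proof. by []. Qed.

Fact cone_map_linear B B' (f : forall k, {linear B k -> B' k}) k :
  linear (fun x : cone B k => (f (k - 1) x.1, f k x.2) : cone B' k).
Proof. by move=> a x y; congr (_, _); rewrite /= linearP. Qed.

Definition cone_map B B' (f : forall k, {linear B k -> B' k}) :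
  chain_map (cone B) (cone B').
Proof.
exists (fun k => mklin (@cone_map_linear _ _ f k)).
by move=> k x; rewrite /= /cone_d_fun /= linear0.
Defined.

Fact to_cone_linear X B (f : forall k, {linear X k -> B k}) k :
  linear (fun x : X k => (f (k - 1) (cc_d X k x), f k x) : cone B k).
Proof. by move=> a x y; congr (_, _); rewrite /= !linearP. Qed.

(** By [to_coneP] every chain map into a cone has this form: chain maps [X -> cone B] are the same
    as graded linear maps [X -> B]. *)
Definition to_cone X B (f : forall k, {linear X k -> B k}) : chain_map X (cone B).
Proof.
exists (fun k => mklin (@to_cone_linear X B f k)).
by move=> k x; rewrite /= /cone_d_fun /= cc_dd linear0.
Defined.

Definition cone_unit A : chain_map A (cone A) := to_cone (fun k => idfun).

Lemma cone_unitE A k (x : A k) : cone_unit A k x = (cc_d A k x, x).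
Proof. by []. Qed.

Lemma cone_unit_inj A : cm_injective (cone_unit A).
Proof. by move=> k x y []. Qed.

Lemma to_coneP X B (f : chain_map X (cone B)) k x :
  f k x = ((f (k - 1) (cc_d X k x)).2, (f k x).2).
Proof. by rewrite cm_comm /= -surjective_pairing. Qed.

(** Since [(0, b)] is the differential of [(b, 0)], a chain map out of a cone is determined on the
    elements [(t, 0)]. *)
Lemma cone_eq B X (f g : chain_map (cone B) X) :
  (forall k (t : B (k - 1)), f k (t, 0) = g k (t, 0)) -> forall k x, f k x = g k x.
Proof.
move=> e k [t b].
have e' : forall b, f k (0, b) = g k (0, b).
  move: k {t b}; apply: int_pred_surj => k b.
  by rewrite -(cone_dE b 0) !cm_comm e.
have -> : ((t, b) : cone B k) = ((t, 0) : cone B k) + ((0, b) : cone B k).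
  by congr (_, _); rewrite /= ?addr0 ?add0r.
by rewrite !linearD e e'.
Qed.

(** The values on [(t, 0)] can be prescribed freely: [(t, b)] is then sent to [p t + d (p b)]. *)
Lemma from_cone B X (p : forall k, {linear B (k - 1) -> X k}) :
  exists g : chain_map (cone B) X, forall k (t : B (k - 1)), g k (t, 0) = p k t.
Proof.
have e1 (k : int) : k = k + 1 - 1 by rewrite addrK.
(* To apply [p] to the second component, of degree [k], this degree is read as [k + 1 - 1]. *)
pose gf k (x : cone B k) : X k := p k x.1 +
  deg_cast (esym (e1 k)) (cc_d X (k + 1) (p (k + 1) (deg_cast (e1 k) x.2))).
have lg k : linear (gf k).
  by move=> a x y; rewrite /gf /= !linearP /= scalerDr addrACA.
have lgE k x : mklin (lg k) x = gf k x by [].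
have gE k t : gf k (t, 0) = p k t by rewrite /gf /= !linear0 addr0.
have gd k (t : B (k - 1)) : gf (k - 1) (0, t) = cc_d X k (p k t).
  rewrite /gf /= linear0 add0r.
  move: (e1 (k - 1)); have ek : k - 1 + 1 = k by rewrite subrK.
  rewrite ek => e; rewrite (eq_irrelevance e erefl) //.
have cg k x : mklin (lg (k - 1)) (cc_d (cone B) k x) = cc_d X k (mklin (lg k) x).
  case: x => t b; rewrite cone_dE !lgE gd /gf linearD.
  have e2 : k + 1 - 1 - 1 = k - 1 by rewrite addrK.
  by rewrite (cc_d_cast _ e2) cc_dd linear0 addr0.
by exists (ChainMap cg).
Qed.

End Cone.

(** * Vanishing of Ext^1 through extension of maps and retractions *)

Section Ext.
Variable R : pzRingType.

Fact pair_linear (U V W : lmodType R) (f : {linear U -> V}) (g : {linear U -> W}) :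
  linear (fun x => (f x, g x) : V * W).
Proof. by move=> a x y; congr (_, _); rewrite /= linearP. Qed.

Definition lpair (U V W : lmodType R) (f : {linear U -> V}) (g : {linear U -> W}) :
  {linear U -> (V * W)%type} := mklin (pair_linear f g).

Fact pair_inr_linear (U V : lmodType R) : linear (fun y : V => (0, y) : U * V).
Proof. by move=> a x y; congr (_, _); rewrite /= scaler0 addr0. Qed.

Definition linr (U V : lmodType R) : {linear V -> (U * V)%type} := mklin (@pair_inr_linear U V).

Definition cm_pair (X Y Z : chain_complex R) (f : chain_map X Y) (g : chain_map X Z) :
  chain_map X (dsum_complex Y Z).
Proof.
exists (fun n => lpair (f n) (g n) : {linear X n -> dsum_complex Y Z n}).
by move=> n x; rewrite /= /dsum_d /= !cm_comm.
Defined.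

Definition cm_opp (X Y : chain_complex R) (f : chain_map X Y) : chain_map X Y.
Proof.
exists (fun n => \- f n : {linear X n -> Y n}).
by move=> n x /=; rewrite cm_comm linearN.
Defined.

Definition dsum_inr (Y X : chain_complex R) : chain_map X (dsum_complex Y X).
Proof.
exists (fun n => linr (Y n) (X n) : {linear X n -> dsum_complex Y X n}).
by move=> n x; congr (_, _); rewrite /= linear0.
Defined.

Lemma cm_coker_exists (X Y : chain_complex R) (f : chain_map X Y) :
  exists (Z : chain_complex R) (p : chain_map Y Z), cm_surjective p /\ cm_exact_at f p.
Proof.
have /dep_choice[Q /dep_choice[p hp]] n := coker_linear_exists (f n).
have sp n : surj (p n) by case: (hp n).
have ep n : exact_at (f n) (p n) by case: (hp n).
have hd n y : p n y = 0 -> p (n - 1) (cc_d Y n y) = 0.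
  by case/ep => x <-; apply/ep; exists (cc_d X n x); rewrite cm_comm.
have [dQ [ddQ [pc hpc]]] := quotient_complex_exists sp hd.
exists (ChainComplex ddQ), pc; split=> n y; first by case: (sp n y) => x <-; exists x.
by rewrite hpc; exact: ep.
Qed.

(* The extension along f is a splitting of the pushout of 0 -> U -> V -> W -> 0 by f. *)
Lemma mod_Ext1_extend (U V W N : lmodType R) (i : {linear U -> V}) (q : {linear V -> W})
    (f : {linear U -> N}) :
  mod_Ext1_eq0 W N -> injective i -> surj q -> exact_at i q ->
  exists g : {linear V -> N}, forall u, g (i u) = f u.
Proof.
move=> ext inji sq ex.
have [P [c [sc ec]]] := coker_linear_exists (lpair f (\- i)).
have [qc hqc] : exists qc : {linear P -> W}, forall x, qc (c x) = (q \o snd) x.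
  apply: linear_factor_surj => // x /ec[u <-] /=; rewrite linearN.
  by rewrite (_ : q (i u) = 0) ?oppr0 //; apply/ex; exists u.
pose a : {linear N -> P} := c \o @pair_inl R V N.
have ia : injective a.
  apply: inj_ker0 => y /ec[u [e1 /eqP]].
  by rewrite oppr_eq0 -(linear0 i) => /eqP/inji u0; rewrite -e1 u0 linear0.
have cE u : c (f u, 0) = c (0, i u).
  apply/eqP; rewrite -subr_eq0 -linearB; apply/eqP/ec; exists u.
  by congr (_, _); rewrite ?subr0 ?sub0r.
have sqc : surj qc by move=> w; case: (sq w) => v <-; exists (c (0, v)); rewrite hqc.
have eac : exact_at a qc.
  move=> z; case: (sc z) => -[y v] <-; rewrite hqc /=; split=> [/ex[u e]|[y' e]].
    exists (y + f u); rewrite /a /= /pair_inl.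
    have -> : ((y + f u, 0) : N * V) = (y, 0) + (f u, 0) by congr (_, _); rewrite ?addr0.
    by rewrite linearD cE -linearD -e; congr (c (_, _)); rewrite /= ?addr0 ?add0r.
  have : c (y - y', v) = 0.
    have -> : ((y - y', v) : N * V) = (y, v) - pair_inl V y' by congr (_, _); rewrite ?subr0.
    by rewrite linearB -e subrr.
  by case/ec => u [_ <-]; rewrite linearN (_ : q (i u) = 0) ?oppr0 //; apply/ex; exists u.
have [h [h1 h2]] := ext (ModExtension ia sqc eac).
(* The first component of the splitting, taken at the class of [(0, v)] in the pushout. *)
exists (fst \o h \o c \o linr N V) => u /=.
rewrite -cE; have /= := h1 (f u); by rewrite /pair_inl => ->.
Qed.

(** A retraction of the inclusion, paired with the projection, is an equivalence with the split
    extension. *)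
Lemma mod_Ext1_eq0P (W N : lmodType R) :
  (forall (U : lmodType R) (i : {linear N -> U}) (q : {linear U -> W}),
     injective i -> surj q -> exact_at i q ->
     exists r : {linear U -> N}, forall y, r (i y) = y) ->
  mod_Ext1_eq0 W N.
Proof.
move=> h [U i q ii sq ex]; have [r hr] := h U i q ii sq ex.
exists (lpair r q); split=> //= y; rewrite hr; congr (_, _).
by apply/ex; exists y.
Qed.

(** The same pushout argument as for modules, carried out with chain maps. *)
Lemma cx_Ext1_extend (U V W N : chain_complex R) (i : chain_map U V) (q : chain_map V W)
    (f : chain_map U N) :
  cx_Ext1_eq0 W N -> cm_injective i -> cm_surjective q -> cm_exact_at i q ->
  exists g : chain_map V N, forall n u, g n (i n u) = f n u.
Proof.
move=> ext inji sq ex.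
have [P [c [sc ec]]] := cm_coker_exists (cm_pair f (cm_opp i)).
have [qc hqc] : exists qc : chain_map P W, forall n x, qc n (c n x) = cm_comp q (dsum_snd N V) n x.
  apply: cm_factor_surj => // n x /ec[u <-] /=; rewrite linearN.
  by rewrite (cm_exact_comp0 ex) oppr0.
pose a : chain_map N P := cm_comp c (dsum_inl N V).
have ia : cm_injective a.
  move=> n; apply: inj_ker0 => y /ec[u [e1 /eqP]].
  by rewrite oppr_eq0 -(linear0 (i n)) => /eqP/inji u0; rewrite -e1 u0 linear0.
have cE n u : c n (f n u, 0) = c n (0, i n u).
  apply/eqP; rewrite -subr_eq0 -linearB; apply/eqP/ec; exists u.
  by congr (_, _); rewrite ?subr0 ?sub0r.
have sqc : cm_surjective qc.
  by move=> n w; case: (sq n w) => v <-; exists (c n (0, v)); rewrite hqc.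
have eac : cm_exact_at a qc.
  move=> n z; case: (sc n z) => -[y v] <-; rewrite hqc /=; split=> [/ex[u e]|[y' e]].
    exists (y + f n u); rewrite /a /= /pair_inl.
    have -> : ((y + f n u, 0) : dsum_complex N V n) = (y, 0) + (f n u, 0).
      by congr (_, _); rewrite ?addr0.
    by rewrite linearD cE -linearD -e; congr (c n (_, _)); rewrite /= ?addr0 ?add0r.
  have : c n (y - y', v) = 0.
    have -> : ((y - y', v) : dsum_complex N V n) = (y, v) - pair_inl (V n) y'.
      by congr (_, _); rewrite ?subr0.
    by rewrite linearB -e subrr.
  by case/ec => u [_ <-]; rewrite linearN (cm_exact_comp0 ex) oppr0.
have [h [h1 h2]] := ext (CxExtension ia sqc eac).
pose fst_cm : chain_map (dsum_complex N W) N :=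
  @ChainMap R (dsum_complex N W) N (fun n => @fst (N n) (W n)) (fun n z => erefl).
exists (cm_comp fst_cm (cm_comp h (cm_comp c (dsum_inr N V)))) => n u /=.
by rewrite -cE; have /= := h1 n (f n u); rewrite /pair_inl => ->.
Qed.

Lemma cx_Ext1_eq0P (W N : chain_complex R) :
  (forall (U : chain_complex R) (i : chain_map N U) (q : chain_map U W),
     cm_injective i -> cm_surjective q -> cm_exact_at i q ->
     exists r : chain_map U N, forall n y, r n (i n y) = y) ->
  cx_Ext1_eq0 W N.
Proof.
move=> h [U i q ii sq ex]; have [r hr] := h U i q ii sq ex.
exists (cm_pair r q); split=> //= n y; rewrite /= hr; congr (_, _).
exact: cm_exact_comp0.
Qed.

End Ext.

(** * Discs and their mapping properties *)

Section Conc.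
Variable R : pzRingType.
Implicit Types (M N L : lmodType R) (X Y : chain_complex R).

(* [conc n M k] is M if k = n and 0 otherwise: the exponent 'I_(k == n) is
   'I_1 or 'I_0, which avoids any transport between degrees. *)
Definition conc (n : int) M (k : int) : lmodType R := {ffun 'I_(k == n) -> M}.

Fact conc_in_linear n M k : linear (fun m : M => [ffun=> m] : conc n M k).
Proof. by move=> a x y; apply/ffunP=> i; rewrite !ffunE. Qed.

Definition conc_in n M k : {linear M -> conc n M k} := mklin (@conc_in_linear n M k).

Fact conc_out_linear n M k : linear (fun x : conc n M k => \sum_i x i).
Proof.
by move=> a x y; rewrite scaler_sumr -big_split; apply: eq_bigr => i _; rewrite !ffunE.
Qed.

Definition conc_out n M k : {linear conc n M k -> M} := mklin (@conc_out_linear n M k).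

Lemma conc_inK n M : cancel (conc_in n M n) (conc_out n M n).
Proof.
move=> m; rewrite /= (eq_bigr (fun=> m)) => [|i _]; last by rewrite ffunE.
by rewrite sumr_const card_ord eqxx.
Qed.

Lemma conc_outK n M k : cancel (conc_out n M k) (conc_in n M k).
Proof.
move=> x; apply/ffunP=> i; rewrite ffunE /= (bigD1 i) //= big1 ?addr0 // => j /eqP[].
apply/val_inj; move: i j {x}; case: (k == n) => -[i i1] [j j1] //=; lia.
Qed.

Lemma conc_eq0 n M k (x : conc n M k) : k != n -> x = 0.
Proof.
by move=> kn; apply/ffunP=> -[i i1]; exfalso; move: i1; rewrite (negbTE kn).
Qed.

Definition conc_map n M N (f : {linear M -> N}) k : {linear conc n M k -> conc n N k} :=
  conc_in n N k \o f \o conc_out n M k.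

Lemma conc_map_in n M N (f : {linear M -> N}) k m :
  conc_map n f k (conc_in n M k m) = conc_in n N k (f m).
Proof.
have [->|kn] := eqVneq k n; last by rewrite (conc_eq0 (conc_in n N k (f m)) kn); exact: conc_eq0.
by rewrite /conc_map [LHS]/=; congr (conc_in n N n (f _)); exact: conc_inK.
Qed.

(** It has [M] in degrees [n + 1] and [n]; the disc that represents degree [n] is therefore
    [disc (n - 1) M]. *)
Definition disc n M : chain_complex R := cone (conc n M).

Definition disc_map n M N (f : {linear M -> N}) : chain_map (disc n M) (disc n N) :=
  cone_map (conc_map n f).

Lemma conc_inP n M k (x : conc n M k) : exists m, x = conc_in n M k m.
Proof. by exists (conc_out n M k x); rewrite conc_outK. Qed.

Lemma disc_map_inl n M N (f : {linear M -> N}) k m :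
  disc_map n f k (conc_in n M (k - 1) m, 0) = (conc_in n N (k - 1) (f m), 0).
Proof. by rewrite -conc_map_in -[LHS]/(_, _) linear0. Qed.

Lemma conc_map_inj n M N (f : {linear M -> N}) k :
  injective f -> injective (conc_map n f k).
Proof.
move=> fi; have [->|kn] := eqVneq k n; last first.
  by move=> x y _; rewrite (conc_eq0 x kn) (conc_eq0 y kn).
move=> x y; case: (conc_inP x) (conc_inP y) => m -> [m' ->].
by rewrite !conc_map_in => /(can_inj (@conc_inK _ _))/fi ->.
Qed.

Lemma conc_map_surj n M N (f : {linear M -> N}) k : surj f -> surj (conc_map n f k).
Proof.
move=> sf y; case: (conc_inP y) => m ->; case: (sf m) => m' <-.
by exists (conc_in n M k m'); rewrite conc_map_in.
Qed.

Lemma conc_map_exact n M N L (f : {linear M -> N}) (g : {linear N -> L}) k :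
  exact_at f g -> exact_at (conc_map n f k) (conc_map n g k).
Proof.
move=> ex; have [->|kn] := eqVneq k n; last first.
  move=> x; rewrite (conc_eq0 x kn) linear0; split=> // _.
  by exists 0; rewrite linear0.
move=> x; case: (conc_inP x) => m ->; rewrite conc_map_in; split.
  rewrite -(linear0 (conc_in n L n)) => /(can_inj (@conc_inK _ _))/ex[m' <-].
  by exists (conc_in n M n m'); rewrite conc_map_in.
case=> y; case: (conc_inP y) => m' ->; rewrite conc_map_in => /(can_inj (@conc_inK _ _)) <-.
by rewrite (_ : g (f m') = 0) ?linear0 //; apply/ex; exists m'.
Qed.

Lemma disc_map_inj n M N (f : {linear M -> N}) :
  injective f -> cm_injective (disc_map n f).
Proof. by move=> fi k [x1 x2] [y1 y2] [] /(conc_map_inj fi)-> /(conc_map_inj fi)->. Qed.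

Lemma disc_map_surj n M N (f : {linear M -> N}) :
  surj f -> cm_surjective (disc_map n f).
Proof.
move=> sf k [y1 y2]; case: (conc_map_surj sf y1) (conc_map_surj sf y2) => x1 <- [x2 <-].
by exists (x1, x2).
Qed.

Lemma disc_map_exact n M N L (f : {linear M -> N}) (g : {linear N -> L}) :
  exact_at f g -> cm_exact_at (disc_map n f) (disc_map n g).
Proof.
move=> ex k [y1 y2]; split=> [e|[[x1 x2] e]].
  have [x1 h1] := (conc_map_exact (n := n) (k := k - 1) ex y1).1 (congr1 fst e).
  have [x2 h2] := (conc_map_exact (n := n) (k := k) ex y2).1 (congr1 snd e).
  by exists (x1, x2); rewrite -h1 -h2.
have e1 := (conc_map_exact (n := n) (k := k - 1) ex y1).2 (ex_intro _ x1 (congr1 fst e)).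
have e2 := (conc_map_exact (n := n) (k := k) ex y2).2 (ex_intro _ x2 (congr1 snd e)).
by rewrite -[0]/(0, 0) -e1 -e2.
Qed.

Lemma disc_eq X n M (f g : chain_map (disc (n - 1) M) X) :
  (forall m, f n (conc_in (n - 1) M (n - 1) m, 0) = g n (conc_in (n - 1) M (n - 1) m, 0)) ->
  forall k x, f k x = g k x.
Proof.
move=> e; apply: cone_eq => k t; have [kn|kn] := eqVneq (k - 1) (n - 1); last first.
  by rewrite (conc_eq0 t kn) -[(0, 0)]/(0 : disc (n - 1) M k) !linear0.
have {}kn : k = n by lia.
by move: t; rewrite kn => t; case: (conc_inP t) => m ->.
Qed.

(** With [disc_eq], this is the adjunction between discs and evaluation: chain maps
    [disc (n - 1) M -> X] are linear maps [M -> X n]. *)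
Lemma from_disc X n M (f : {linear M -> X n}) :
  exists g : chain_map (disc (n - 1) M) X,
    forall m, g n (conc_in (n - 1) M (n - 1) m, 0) = f m.
Proof.
(* Quantifying over the equality of degrees makes the condition empty away from degree [n], where
   the zero map is taken. *)
pose P k (g : {linear conc (n - 1) M (k - 1) -> X k}) :=
  forall e : n = k, forall m, g (conc_in (n - 1) M (k - 1) m) = deg_cast e (f m).
have /dep_choice[p hp] k : exists g, @P k g.
  have [<-|kn] := eqVneq n k.
    exists (f \o conc_out _ _ _) => e m; rewrite (eq_irrelevance e erefl).
    by rewrite [LHS]/=; congr (f _); exact: conc_inK.
  by exists \0 => e; rewrite e eqxx in kn.
have [g hg] := from_cone p; exists g => m.
by rewrite hg (hp n erefl).
Qed.

(** The adjunction on the other side: [disc n] is right adjoint to evaluation in degree [n]. *)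
Lemma to_disc X n M (f : {linear X n -> M}) :
  exists g : chain_map X (disc n M),
    forall x, (g n x).2 = conc_in n M n (f x).
Proof.
pose P k (g : {linear X k -> conc n M k}) :=
  forall e : k = n, forall x, g x = conc_in n M k (f (deg_cast e x)).
have /dep_choice[p hp] k : exists g, @P k g.
  have [->|kn] := eqVneq k n.
    by exists (conc_in _ _ _ \o f) => e x; rewrite (eq_irrelevance e erefl).
  by exists \0 => e; rewrite e eqxx in kn.
by exists (to_cone p) => x; rewrite -(hp n erefl).
Qed.

Lemma fg_conc n M k : fg_module M -> fg_module (conc n M k).
Proof.
case=> s [g hg]; exists s, (conc_in n M k \o g) => x.
have [a ha] := hg (conc_out n M k x); exists a.
rewrite -{1}[x]conc_outK ha linear_sum; apply: eq_bigr => i _.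
exact: linearZ_LR.
Qed.

Lemma fg_prod M N : fg_module M -> fg_module N -> fg_module (M * N)%type.
Proof.
case=> m [g hg] [n [h hh]].
exists (m + n)%N, (fun i => match split i with inl j => (g j, 0) | inr j => (0, h j) end).
case=> x y; case: (hg x) => a ->; case: (hh y) => b ->.
exists (fun i => match split i with inl j => a j | inr j => b j end).
rewrite big_split_ord /=.
have Kl i : split (lshift n i) = inl i := unsplitK (inl i).
have Kr i : split (rshift m i) = inr i := unsplitK (inr i).
under [X in _ = X + _]eq_bigr do rewrite Kl.
under [X in _ = _ + X]eq_bigr do rewrite Kr.
have -> : \sum_(i < m) a i *: ((g i, 0) : M * N) = (\sum_(i < m) a i *: g i, 0).
  by elim/big_rec2: _ => // i u v _ ->; congr (_, _); rewrite /= scaler0 addr0.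
have -> : \sum_(i < n) b i *: ((0, h i) : M * N) = (0, \sum_(i < n) b i *: h i).
  by elim/big_rec2: _ => // i u v _ ->; congr (_, _); rewrite /= scaler0 addr0.
by congr (_, _); rewrite /= ?addr0 ?add0r.
Qed.

Lemma fg_disc n M : fg_module M -> fg_complex (disc n M).
Proof.
move=> fM; split=> [|k]; last by apply: fg_prod; apply: fg_conc.
exists n, (n + 1) => k kn [x y].
have k1 : k - 1 != n by lia.
have k2 : k != n by lia.
by rewrite (conc_eq0 x k1) (conc_eq0 y k2).
Qed.

Lemma projective_disc n M : projective_module M -> projective_complex (disc (n - 1) M).
Proof.
move=> pM X Y p f sp.
have [g hg] := pM _ _ (p n) (f n \o (@pair_inl _ _ _) \o conc_in (n - 1) M (n - 1)) (sp n).
have [g' hg'] := from_disc g.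
exists g' => k x; rewrite -[p k _]/(cm_comp p g' k x).
by apply: disc_eq => m /=; rewrite hg' hg.
Qed.

(** Evaluation is left adjoint to [disc n], which preserves surjections; the lifting problem is
    moved to discs and back. *)
Lemma projective_component n X : projective_complex X -> projective_module (X n).
Proof.
move=> pX U V p f sp; have [g hg] := to_disc f.
have [h hh] := pX _ _ (disc_map n p) g (disc_map_surj sp).
exists (conc_out n U n \o snd \o h n) => x.
have /(congr1 snd) := hh n x.
rewrite hg => /(congr1 (conc_out n V n)); rewrite conc_inK => <-.
change (p (conc_out n U n (h n x).2) = conc_out n V n (conc_map n p n (h n x).2)).
by case: (conc_inP (h n x).2) => m ->; rewrite conc_map_in !conc_inK.
Qed.

End Conc.

(** * Finiteness, absolute cleanness and injectivity for discs, cones and components *)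

Section AbsClean.
Variable R : pzRingType.
Implicit Types (M N : lmodType R) (X Y A : chain_complex R).

Lemma FPinf_disc n M : FPinf_module M -> FPinf_complex (disc (n - 1) M).
Proof.
case=> P [d [e [hP se ex exs]]].
exists (fun m => disc (n - 1) (P m)), (fun m => disc_map (n - 1) (d m)), (disc_map (n - 1) e).
split=> [m|||m]; last 3 first.
- exact: disc_map_surj.
- exact: disc_map_exact.
- exact: disc_map_exact.
by case: (hP m) => fP pP; split; [exact: fg_disc|exact: projective_disc].
Qed.

Lemma FPinf_component n X : FPinf_complex X -> FPinf_module (X n).
Proof.
case=> P [d [e [hP se ex exs]]].
exists (fun m => P m n), (fun m => d m n), (e n); split=> [m|||m].
- by case: (hP m) => -[_ fP] pP; split=> //; exact: projective_component.
- exact: se.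
- exact: ex.
- exact: exs.
Qed.

Lemma abs_clean_injective M : injective_module M -> abs_clean_module M.
Proof.
by move=> iM W _; apply: mod_Ext1_eq0P => U i q ii _ _; exact: (iM _ _ i idfun ii).
Qed.

(** Discs turn an extension of [M] by [A n] into an extension of complexes with quotient of type
    FP-infinity. The canonical map from the disc on [A n] to [A] extends over it, and degree [n] of
    this extension is a retraction. *)
Lemma abs_clean_component n A : abs_clean_complex A -> abs_clean_module (A n).
Proof.
move=> cA M fM; apply: mod_Ext1_eq0P => E i q ii sq ex.
have [c hc] := from_disc (idfun : {linear A n -> A n}).
have [g hg] := cx_Ext1_extend c (cA _ (FPinf_disc n fM))
  (disc_map_inj (n := n - 1) ii) (disc_map_surj (n := n - 1) sq) (disc_map_exact (n := n - 1) ex).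
exists (g n \o @pair_inl _ _ _ \o conc_in (n - 1) E (n - 1)) => y.
by rewrite -[RHS](hc y) -hg disc_map_inl.
Qed.

(** In every degree [conc n M k] is a retract of [M], by [conc_outK]. *)
Lemma abs_clean_conc n M k : abs_clean_module M -> abs_clean_module (conc n M k).
Proof.
move=> cM W fW; apply: mod_Ext1_eq0P => U i q ii sq ex.
have [g hg] := mod_Ext1_extend (conc_out n M k) (cM _ fW) ii sq ex.
by exists (conc_in n M k \o g) => y; rewrite [LHS]/= hg; exact: conc_outK.
Qed.

(* A retraction of the underlying graded modules onto the bottom copy of B
   determines a retraction of complexes. *)
Lemma abs_clean_cone (B : int -> lmodType R) :
  (forall k, abs_clean_module (B k)) -> abs_clean_complex (cone B).
Proof.
move=> cB W fW; apply: cx_Ext1_eq0P => U i q ii sq ex.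
have /dep_choice[r hr] k : exists r : {linear U k -> B k}, forall x, r (i k x) = x.2.
  exact: (mod_Ext1_extend (snd : {linear cone B k -> B k})
    (cB k _ (FPinf_component k fW)) (ii k) (sq k) (ex k)).
exists (to_cone r) => k x; rewrite /= -cm_comm !hr.
by case: x.
Qed.

Lemma abs_clean_disc n M : abs_clean_module M -> abs_clean_complex (disc n M).
Proof. by move=> cM; apply: abs_clean_cone => k; exact: abs_clean_conc. Qed.

Lemma injective_component n X : injective_complex X -> injective_module (X n).
Proof.
move=> iX U V i f ii; have [g hg] := from_disc f.
have [h hh] := iX _ _ _ g (disc_map_inj (n := n - 1) ii).
exists (h n \o @pair_inl _ _ _ \o conc_in (n - 1) V (n - 1)) => x.
by rewrite -[RHS](hg x) -hh disc_map_inl.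
Qed.

(** Maps into a cone are graded maps, so it suffices to extend the second components degree by
    degree. *)
Lemma injective_cone (B : int -> lmodType R) :
  (forall k, injective_module (B k)) -> injective_complex (cone B).
Proof.
move=> iB X Y i f ii.
have /dep_choice[r hr] k : exists r : {linear Y k -> B k}, forall x, r (i k x) = (f k x).2.
  exact: (iB k _ _ (i k) (snd \o f k) (ii k)).
by exists (to_cone r) => k x; rewrite /= -cm_comm !hr -to_coneP.
Qed.

End AbsClean.

(** * Transport of degrees and suspensions *)

Section Shift.
Variable R : pzRingType.
Implicit Types (X Y A : chain_complex R).

Lemma deg_castE (Y : int -> lmodType R) m n (e e' : m = n) (y : Y m) :
  deg_cast e y = deg_cast e' y.
Proof. by rewrite (eq_irrelevance e e'). Qed.

Lemma deg_cast_id (Y : int -> lmodType R) m (e : m = m) (y : Y m) : deg_cast e y = y.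
Proof. by rewrite (eq_irrelevance e erefl). Qed.

Lemma deg_cast_eq0 (Y : int -> lmodType R) m n (e : m = n) (y : Y m) :
  deg_cast e y = 0 <-> y = 0.
Proof. by case: n / e. Qed.

Lemma deg_castB (Y : int -> lmodType R) m n (e : m = n) :
  {morph deg_cast (Y := Y) e : x y / x - y}.
Proof. exact: linearB. Qed.

Lemma deg_cast_nat (Y Z : int -> lmodType R) (f : forall k, {linear Y k -> Z k})
  m n (e : m = n) (y : Y m) : f n (deg_cast e y) = deg_cast e (f m y).
Proof. by case: n / e. Qed.

Lemma deg_cast_reindex (Y : int -> lmodType R) (h : int -> int) m n (e : m = n)
    (e' : h m = h n) (y : Y (h m)) :
  deg_cast (Y := fun k => Y (h k)) e y = deg_cast (Y := Y) e' y.
Proof. by case: n / e e' => e'; exact: esym (deg_cast_id e' y). Qed.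

Lemma deg_cast_shift (Y : int -> lmodType R) p m n (e : m = n) (e' : m + p = n + p)
  (y : Y (m + p)) : deg_cast (Y := fun k => Y (k + p)) e y = deg_cast (Y := Y) e' y.
Proof. exact: (deg_cast_reindex (h := +%R^~ p)). Qed.

(** A sign given by a boolean commutes with linear maps and transports by mere case analysis. *)
Definition neg_if (V : lmodType R) (b : bool) (v : V) : V := if b then - v else v.

Fact neg_if_linear V b : linear (@neg_if V b).
Proof. by move=> a x y; case: b => //=; rewrite scalerN opprD. Qed.

Lemma neg_ifK V b : involutive (@neg_if V b).
Proof. by move=> x; case: b; rewrite /= ?opprK. Qed.

Lemma neg_ifN (V : lmodType R) b (v : V) : neg_if (~~ b) v = - neg_if b v.
Proof. by case: b; rewrite /= ?opprK. Qed.

Lemma linear_neg_if (U V : lmodType R) (f : {linear U -> V}) b x :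
  f (neg_if b x) = neg_if b (f x).
Proof. by case: b => //; exact: linearN. Qed.

Lemma deg_cast_neg_if (Y : int -> lmodType R) m n (e : m = n) b (y : Y m) :
  deg_cast e (neg_if b y) = neg_if b (deg_cast e y).
Proof. by case: n / e. Qed.

Lemma neg_if_eq0 (V : lmodType R) b (v : V) : neg_if b v = 0 <-> v = 0.
Proof. by case: b => //; split=> [/eqP|->]; rewrite /= ?oppr0 // oppr_eq0 => /eqP. Qed.

Definition shift_obj (n : int) X (k : int) : lmodType R := X (k + n).

Definition shift_d_fun n b X k (x : shift_obj n X k) : shift_obj n X (k - 1) :=
  neg_if b (deg_cast (addrAC k n (- 1)) (cc_d X (k + n) x)).

Fact shift_d_linear n b X k : linear (@shift_d_fun n b X k).
Proof. by move=> a x y; rewrite /shift_d_fun !linearP neg_if_linear. Qed.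

Definition shift_d n b X k : {linear shift_obj n X k -> shift_obj n X (k - 1)} :=
  mklin (@shift_d_linear n b X k).

Fact shift_dd n b X k x : shift_d n b X (k - 1) (shift_d n b X k x) = 0.
Proof.
rewrite /= /shift_d_fun !linear_neg_if neg_ifK.
by rewrite (cc_d_cast _ (congr1 (+%R^~ (- 1)) (addrAC k n (- 1)))) cc_dd !linear0.
Qed.

(* [shift n b X] is the suspension Sigma^(-n) X, with the differential of
   X multiplied by (-1)^b. *)
Definition shift n b X : chain_complex R := ChainComplex (@shift_dd n b X).

Lemma shift_dE n b X k x :
  cc_d (shift n b X) k x = neg_if b (deg_cast (addrAC k n (- 1)) (cc_d X (k + n) x)).
Proof. by []. Qed.

Definition shift_map n b X Y (f : chain_map X Y) : chain_map (shift n b X) (shift n b Y).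
Proof.
exists (fun k => f (k + n) : {linear shift n b X k -> shift n b Y k}).
by move=> k x; rewrite !shift_dE linear_neg_if (deg_cast_nat (cm_fun f)) cm_comm.
Defined.

(* One of the two transpositions of the adjunction between [shift n b] and its
   inverse [shift (- n) b]; taking m with n + m = 0 avoids the degree - - n. *)
Lemma shift_to n m b X Y (e : n + m = 0) (f : chain_map (shift n b X) Y) :
  exists g : chain_map X (shift m b Y),
    forall k (e' : k = k + m + n) x, g k x = f (k + m) (deg_cast e' x).
Proof.
have ek (k : int) : k = k + m + n by lia.
pose g k : {linear X k -> shift m b Y k} := f (k + m) \o deg_cast (ek k).
have gE k x : g k x = f (k + m) (deg_cast (ek k) x) by [].
have cg k x : g (k - 1) (cc_d X k x) = cc_d (shift m b Y) k (g k x).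
  rewrite shift_dE !gE -cm_comm shift_dE linear_neg_if deg_cast_neg_if neg_ifK.
  rewrite -(deg_cast_nat (cm_fun f)); congr (f _ _).
  rewrite (cc_d_cast _ (congr1 (+%R^~ (- 1)) (ek k))).
  have e1 : k - 1 = k - 1 + m + n by lia.
  have e2 : k - 1 = k + m - 1 + n by lia.
  have e3 : k + m - 1 + n = k - 1 + m + n by lia.
  rewrite (deg_castK _ _ e2) (deg_cast_shift _ e3) (deg_castK _ _ e1);
    exact: (deg_castE (Y := X)).
exists (ChainMap cg) => k e' x; rewrite -[LHS]/(g k x) gE.
by congr (f _ _); exact: (deg_castE (Y := X)).
Qed.

Lemma shift_from n m b X Y (e : n + m = 0) (f : chain_map X (shift m b Y)) :
  exists g : chain_map (shift n b X) Y,
    forall k (e' : k + n + m = k) x, g k x = deg_cast e' (f (k + n) x).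
Proof.
have ek (k : int) : k + n + m = k by lia.
pose g k : {linear shift n b X k -> Y k} := deg_cast (ek k) \o f (k + n).
have gE k x : g k x = deg_cast (ek k) (f (k + n) x) by [].
have cg k x : g (k - 1) (cc_d (shift n b X) k x) = cc_d Y k (g k x).
  rewrite shift_dE !gE linear_neg_if deg_cast_neg_if (deg_cast_nat (cm_fun f)) cm_comm shift_dE.
  rewrite !deg_cast_neg_if neg_ifK.
  rewrite (cc_d_cast _ (congr1 (+%R^~ (- 1)) (ek k))).
  have e1 : k + n - 1 + m = k - 1 by lia.
  have e2 : k + n + m - 1 = k - 1 by lia.
  have e3 : k + n - 1 + m = k - 1 + n + m by lia.
  by rewrite (deg_cast_shift _ e3) (deg_castK _ _ e1) (deg_castK _ _ e2);
    exact: (deg_castE (Y := Y)).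
exists (ChainMap cg) => k e' x; rewrite -[LHS]/(g k x) gE; exact: (deg_castE (Y := Y)).
Qed.

(** Shift a resolution termwise; a lifting problem against a shifted projective is transposed to one
    against the original by the inverse shift. *)
Lemma FPinf_shift n b X : FPinf_complex X -> FPinf_complex (shift n b X).
Proof.
case=> P [d [e [hP se ex exs]]].
exists (fun m => shift n b (P m)), (fun m => shift_map n b (d m)), (shift_map n b e).
split=> [m|k|k|m k]; last 3 first.
- exact: se.
- exact: ex.
- exact: exs.
case: (hP m) => -[[lo [hi bP]] fP] pP; split.
  split=> [|k]; last exact: fP.
  by exists (lo - n), (hi - n) => k hk; apply: bP; lia.
move=> Y Z p f sp; have e0 : n + - n = 0 by rewrite subrr.
have [f' hf'] := shift_to e0 f.
have [g hg] := pP _ _ (shift_map (- n) b p) f' (fun k => sp (k - n)).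
have [g' hg'] := shift_from e0 g; exists g' => k x.
have ek : k + n - n = k by rewrite addrK.
have ek' : k + n = k + n - n + n by rewrite addrK.
rewrite (hg' _ ek) (deg_cast_nat (cm_fun p)) -[p _ _]/(shift_map (- n) b p _ _) hg (hf' _ ek').
rewrite -(deg_cast_nat (cm_fun f)) (deg_cast_shift _ (esym ek')) (deg_castK _ _ erefl).
by rewrite deg_cast_id.
Qed.

(** An extension of [W] by the shift of [A] is transposed to an extension of the inverse shift of
    [W] by [A]; a retraction found there is transposed back. *)
Lemma abs_clean_shift n b A : abs_clean_complex A -> abs_clean_complex (shift n b A).
Proof.
move=> cA W fW; apply: cx_Ext1_eq0P => U i q ii sq ex.
have e0 : n + - n = 0 by rewrite subrr.
have [i' hi'] := shift_to e0 i.
have ii' : cm_injective i'.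
  move=> k x y; have ek : k = k - n + n by rewrite subrK.
  by rewrite !(hi' _ ek) => /ii /(congr1 (deg_cast (esym ek))); rewrite !(deg_castK _ _ erefl).
have ex' : cm_exact_at i' (shift_map (- n) b q).
  move=> k y; apply: (iff_trans (ex (k - n) y)).
  have ek : k = k - n + n by rewrite subrK.
  split=> [[x <-]|[x <-]]; last by exists (deg_cast ek x); rewrite (hi' _ ek).
  by exists (deg_cast (esym ek) x); rewrite (hi' _ ek) (deg_castK _ _ erefl).
have sq' : cm_surjective (shift_map (- n) b q) by move=> k; exact: sq.
have [r hr] := cx_Ext1_extend (cm_id A) (cA _ (FPinf_shift (- n) b fW)) ii' sq' ex'.
have e1 : - n + n = 0 by rewrite addNr.
have [r' hr'] := shift_to e1 r; exists r' => k y.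
have ek : k = k + n - n by rewrite addrK.
have ek' : k + n = k + n - n + n by rewrite addrK.
rewrite (hr' _ ek) -[RHS](hr (k + n) y) (hi' _ ek').
by congr (r _ _); rewrite -(deg_cast_nat (cm_fun i)) (deg_cast_shift _ ek').
Qed.

End Shift.

(** * Gorenstein AC-injective modules *)

Section GorensteinModules.
Variable R : pzRingType.
Implicit Types (A J K M N : lmodType R) (I X : chain_complex R).

Lemma shift_d_eq0 n b X k (e : k - 1 + n = k + n - 1) (y : X (k - 1 + n)) :
  cc_d (shift n b X) (k - 1) y = 0 <-> cc_d X (k + n - 1) (deg_cast e y) = 0.
Proof.
rewrite shift_dE; apply: (iff_trans (neg_if_eq0 _ _)).
rewrite (cc_d_cast _ (congr1 (+%R^~ (- 1)) e)).
rewrite deg_cast_eq0; exact: (deg_cast_eq0 (Y := X)).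
Qed.

Lemma shift_d_eq n b X k (e : k - 1 + n = k + n - 1) (x : X (k + n)) (y : X (k - 1 + n)) :
  cc_d (shift n b X) k x = y <-> cc_d X (k + n) x = deg_cast e (neg_if b y).
Proof.
rewrite shift_dE; split=> [<-|h].
  by rewrite neg_ifK (deg_castK _ _ erefl).
by rewrite h (deg_castK _ _ erefl) deg_cast_id neg_ifK.
Qed.

Definition totally_acyclic I : Prop :=
  [/\ forall n, injective_module (I n),
      complex_exact I
    & forall A : lmodType R, abs_clean_module A ->
      forall (n : int) (g : {linear A -> I (n - 1)}),
        (forall a, cc_d I (n - 1) (g a) = 0) <->
        exists h : {linear A -> I n}, forall a, cc_d I n (h a) = g a].

Lemma totally_acyclic_shift n b I : totally_acyclic I -> totally_acyclic (shift n b I).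
Proof.
case=> iI eI hI; split=> [k|k y|A cA k g]; first exact: iI.
  have e : k - 1 + n = k + n - 1 by lia.
  rewrite (shift_d_eq0 _ e) (eI (k + n)); split=> -[x hx].
    exists (neg_if b x); apply/(shift_d_eq _ e).
    by rewrite linear_neg_if hx deg_cast_neg_if.
  by exists (neg_if b x); move/(shift_d_eq _ e): hx;
     rewrite deg_cast_neg_if => h; rewrite linear_neg_if h neg_ifK.
have e : k - 1 + n = k + n - 1 by lia.
pose g' : {linear A -> I (k + n - 1)} := deg_cast e \o g.
have [h1 h2] := hI A cA _ g'; split=> [hg|[h hh] a]; last first.
  apply/(shift_d_eq0 _ e)/h2.
  exists (mklin (@neg_if_linear _ _ b) \o h) => x; move/(shift_d_eq _ e): (hh x).
  by rewrite deg_cast_neg_if => e1; rewrite /= linear_neg_if e1 neg_ifK.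
have [|h hh] := h1; first by move=> a; apply/(shift_d_eq0 _ e)/hg.
exists (mklin (@neg_if_linear _ _ b) \o h) => a; apply/(shift_d_eq _ e).
by rewrite /= linear_neg_if hh deg_cast_neg_if.
Qed.

(** Shifting by [n] moves the kernel from degree [n] to degree 0. Hence every cycle module of a
    totally acyclic complex is Gorenstein AC-injective, which supplies syzygies and cosyzygies. *)
Lemma GAC_injective_moduleP N :
  GAC_injective_module N <->
  exists2 I, totally_acyclic I &
    exists (n : int) (i : {linear N -> I n}), injective i /\ exact_at i (cc_d I n).
Proof.
split=> [[I [iI eI [i hi] hI]]|[I tI [n [i [ii ei]]]]].
  by exists I; [split|exists 0, i].
have [iI eI hI] := totally_acyclic_shift n false tI.
exists (shift n false I); split=> //.
have e : n = 0 + n by rewrite add0r.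
exists (deg_cast e \o i); split=> [x y /=|y].
  by move=> /(congr1 (deg_cast (esym e))); rewrite !(deg_castK _ _ erefl) => /ii.
move: y; rewrite -[cc_d _ 0]/(shift_d n false I 0).
split=> [h|[x <-]].
  have /ei[x hx] : cc_d I n (deg_cast (esym e) y) = 0.
    rewrite (cc_d_cast _ (congr1 (+%R^~ (- 1)) (esym e))).
    move/(congr1 (deg_cast (esym (addrAC 0 n (- 1))))): h.
    by rewrite /= /shift_d_fun /= (deg_castK _ _ erefl) linear0 => /= ->; rewrite linear0.
  by exists x; rewrite /= hx (deg_castK _ _ erefl).
rewrite /= /shift_d_fun /= (cc_d_cast _ (congr1 (+%R^~ (- 1)) e)).
have -> : cc_d I n (i x) = 0 by apply/ei; exists x.
by rewrite !linear0.
Qed.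

Lemma GAC_module_left N : GAC_injective_module N ->
  exists J K (i : {linear K -> J}) (p : {linear J -> N}),
    [/\ injective_module J, GAC_injective_module K, injective i, surj p & exact_at i p].
Proof.
(* The degree of [N] is renamed [n - 1], so that the differential of [I n] maps onto [N]. *)
case/GAC_injective_moduleP=> I tI [m]; have -> : m = m + 1 - 1 by rewrite addrK.
move: (m + 1) => {m} n [i [ii ei]].
have [iI eI hI] := tI.
have [p hp] : exists p : {linear I n -> N}, forall x, i (p x) = cc_d I n x.
  by apply: linear_lift_inj => // x; apply/ei; rewrite cc_dd.
have [K [j [ij ej]]] := ker_linear_exists (cc_d I n).
exists (I n), K, j, p; split=> //.
- by apply/GAC_injective_moduleP; exists I => //; exists n, j.
- move=> y; have /eI[x hx] : cc_d I (n - 1) (i y) = 0 by apply/ei; exists y.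
  by exists x; apply: ii; rewrite hp hx.
move=> x; rewrite -(ej x) -hp; split=> [->|]; first exact: linear0.
by rewrite -(linear0 i) => /ii.
Qed.

Lemma GAC_module_right N : GAC_injective_module N ->
  exists J K (i : {linear N -> J}) (p : {linear J -> K}),
    [/\ injective_module J, GAC_injective_module K, injective i, surj p & exact_at i p].
Proof.
case/GAC_injective_moduleP=> I tI [n [i [ii ei]]]; have [iI eI hI] := tI.
have [K [j [ij ej]]] := ker_linear_exists (cc_d I (n - 1)).
have [p hp] : exists p : {linear I n -> K}, forall x, j (p x) = cc_d I n x.
  by apply: linear_lift_inj => // x; apply/ej; rewrite cc_dd.
exists (I n), K, i, p; split=> //.
- by apply/GAC_injective_moduleP; exists I => //; exists (n - 1), j.
- move=> y; have /eI[x hx] : cc_d I (n - 1) (j y) = 0 by apply/ej; exists y.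
  by exists x; apply: ij; rewrite hp hx.
move=> x; rewrite -(ei x) -hp; split=> [->|]; first exact: linear0.
by rewrite -(linear0 j) => /ij.
Qed.

(** The resolution has [J * J] in every degree, with differential [(t, b) |-> (0, t)]: it is
    contractible, with cycles the second copy of [J]. *)
Lemma GAC_module_injective J : injective_module J -> GAC_injective_module J.
Proof.
move=> iJ; exists (cone (fun _ => J)); split.
- move=> n U V i f ii.
  have [g1 h1] := iJ _ _ i (fst \o f) ii; have [g2 h2] := iJ _ _ i (snd \o f) ii.
  by exists (lpair g1 g2) => x; rewrite /= h1 h2 -surjective_pairing.
- move=> n [y1 y2]; rewrite cone_dE; split=> [[->]|[[x1 x2] [<- _]]//].
  by exists (y2, 0).
- exists (linr J J); split=> [x y []//|[y1 y2]].
  by rewrite cone_dE; split=> [[->]|[x [<- _]]//]; exists y2.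
move=> A cA n g; split=> [hg|[h hh] a]; last by rewrite -hh cc_dd.
exists (@pair_inl R J J \o snd \o g) => a.
have := congr1 snd (hg a); rewrite [LHS]/= => g1.
by rewrite [RHS]surjective_pairing g1.
Qed.

Lemma GAC_module_prod M N :
  GAC_injective_module M -> GAC_injective_module N -> GAC_injective_module (M * N)%type.
Proof.
case=> I [iI eI [i [ii ei]] hI] [J [iJ eJ [j [ij ej]] hJ]].
exists (dsum_complex I J); split.
- move=> n U V u f iu.
  have [g1 h1] := iI n _ _ u (fst \o f) iu; have [g2 h2] := iJ n _ _ u (snd \o f) iu.
  by exists (lpair g1 g2) => x; rewrite /= h1 h2 -surjective_pairing.
- move=> n [y1 y2]; split=> [[/eI[x1 <-] /eJ[x2 <-]]|[x <-]]; last exact: cc_dd.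
  by exists (x1, x2).
- exists (lpair (i \o fst) (j \o snd)); split=> [[x1 x2] [y1 y2] [/ii-> /ij->]//|[y1 y2]].
  split=> [[/ei[x1 <-] /ej[x2 <-]]|[[x1 x2] [<- <-]]]; first by exists (x1, x2).
  by congr (_, _); [apply/ei; exists x1|apply/ej; exists x2].
move=> A cA n g; split=> [hg|[h hh] a]; last by rewrite -hh cc_dd.
have [h1 hh1] := (hI A cA n (fst \o g)).1 (fun a => congr1 fst (hg a)).
have [h2 hh2] := (hJ A cA n (snd \o g)).1 (fun a => congr1 snd (hg a)).
exists (lpair h1 h2) => a; rewrite /= /dsum_d /= hh1 hh2 /=; exact: esym (surjective_pairing _).
Qed.

(* Extend N -> I^0 to e : U -> I^0; then U is the pullback of V -> I^1 along
   d : I^0 -> I^1, and A -> V -> I^1 lifts to I^0. *)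
Lemma GAC_module_lift (U V : lmodType R) N A (i : {linear N -> U}) (p : {linear U -> V})
    (f : {linear A -> V}) :
  GAC_injective_module N -> abs_clean_module A ->
  injective i -> surj p -> exact_at i p ->
  exists g : {linear A -> U}, forall a, p (g a) = f a.
Proof.
case=> I [iI eI [j [ij ej]] hI] cA ii sp ep.
have [e he] := iI 0 _ _ i j ii.
have [w hw] : exists w : {linear V -> I (0 - 1)}, forall u, w (p u) = (cc_d I 0 \o e) u.
  apply: linear_factor_surj => // u /ep[x <-] /=.
  by rewrite he; apply/ej; exists x.
have [h hh] : exists h : {linear A -> I 0}, forall a, cc_d I 0 (h a) = (w \o f) a.
  apply/(hI A cA 0) => a /=; case: (sp (f a)) => u <-.
  by rewrite hw cc_dd.
have ipe : injective (lpair p e).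
  apply: inj_ker0 => u [/ep[x <-]].
  by rewrite he -(linear0 j) => /ij ->; rewrite linear0.
have [a|g hg] := linear_lift_inj (f := lpair f h) ipe.
  case: (sp (f a)) => u hu.
  (* Any [u] above [f a] satisfies [e u = h a] up to an element [j x] of [N]; subtracting [i x] from
     [u] corrects it. *)
  have /ej[x hx] : cc_d I 0 (e u - h a) = 0 by rewrite linearB hh /= -hu hw subrr.
  exists (u - i x) => /=; rewrite !linearB he hx hu subKr.
  by rewrite (_ : p (i x) = 0) ?subr0 //; apply/ep; exists x.
by exists g => a; case: (hg a).
Qed.

End GorensteinModules.

(** * Null homotopies, and syzygies of complexes *)

Section NullHomotopy.
Variable R : pzRingType.
Implicit Types (A X Y I K S : chain_complex R).

Lemma null_homotopicP A X (f : chain_map A X) :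
  null_homotopic f <->
  exists g : chain_map (cone A) X, forall n x, g n (cone_unit A n x) = f n x.
Proof.
split=> [[s hs]|[g hg]].
  (* Forced by [(t, b) = (d b, b) + (t - d b, 0)], with value [f b] on the first summand and
     [s (t - d b)] on the second. *)
  pose gf n (x : cone A n) : X n := s n x.1 + f n x.2 - s n (cc_d A n x.2).
  have lg n : linear (gf n).
    by move=> a x y; rewrite /gf /= !linearP /= !scalerDr [X in X + _ = _]addrACA; exact: addrACA.
  have cg n x : mklin (lg (n - 1)) (cc_d (cone A) n x) = cc_d X n (mklin (lg n) x).
    have ds y : cc_d X n (s n y) = f (n - 1) y - s (n - 1) (cc_d A (n - 1) y).
      by rewrite hs addrK.
    rewrite /= /gf /= linear0 add0r linearB linearD !ds.
    by rewrite cc_dd linear0 subr0 cm_comm addrK.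
  exists (ChainMap cg) => n x /=; rewrite /gf /=.
  by rewrite addrAC subrr add0r.
exists (fun n => g n \o @pair_inl _ _ _) => n x /=.
rewrite -hg cone_unitE -(cm_comm g (x, 0)) cone_dE -(linearD (g (n - 1))); congr (g _ _).
by congr (_, _); rewrite /= ?addr0 ?add0r.
Qed.

(** The quotient map is [(t, b) |-> t - d b], whose kernel is the graph of [d]. As [(0, t)] goes to
    [- d t], the differential of the quotient acquires a sign. *)
Lemma cone_suspension A :
  exists p : chain_map (cone A) (shift (- 1) true A),
    cm_surjective p /\ cm_exact_at (cone_unit A) p.
Proof.
pose pf k (x : cone A k) : shift (- 1) true A k := x.1 - cc_d A k x.2.
have lp k : linear (pf k).
  by move=> a x y; rewrite /pf /= linearP scalerBr opprD addrACA.
have cp k x : mklin (lp (k - 1)) (cc_d (cone A) k x)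
    = cc_d (shift (- 1) true A) k (mklin (lp k) x).
  case: x => t b; rewrite shift_dE deg_cast_id /= /pf /= sub0r linearB.
  by rewrite cc_dd subr0.
exists (ChainMap cp); split=> [k y|k [t b]].
  by exists (y, 0); rewrite /= /pf /= linear0 subr0.
rewrite /= /pf /=; split=> [/eqP|[x [<- <-]]]; last by rewrite subrr.
by rewrite subr_eq0 => /eqP ->; exists b.
Qed.

Lemma abs_clean_cosyzygy A : abs_clean_complex A ->
  exists A' (p : chain_map (cone A) A'),
    [/\ abs_clean_complex A', cm_surjective p & cm_exact_at (cone_unit A) p].
Proof.
move=> cA; have [p [sp ep]] := cone_suspension A.
by exists (shift (- 1) true A), p; split=> //; exact: abs_clean_shift.
Qed.

(** [S] is the desuspension of [A]; the quotient of [cone S] by [S] is identified with [A] by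
    transposing the identity of [S]. *)
Lemma abs_clean_syzygy A : abs_clean_complex A ->
  exists S (p : chain_map (cone S) A),
    [/\ abs_clean_complex S, cm_surjective p & cm_exact_at (cone_unit S) p].
Proof.
move=> cA; pose S := shift 1 true A.
have [p [sp ep]] := cone_suspension S.
have [g hg] := shift_from (addNr 1) (cm_id S).
exists S, (cm_comp g p); split; first exact: abs_clean_shift.
  move=> k y; have e : k - 1 + 1 = k by rewrite subrK.
  case: (sp k (deg_cast (esym e) y)) => x hx; exists x.
  by rewrite /= hx (hg _ e) (deg_castK _ _ erefl).
move=> k x; rewrite -(ep k x) /=.
have e : k - 1 + 1 = k by rewrite subrK.
by rewrite (hg _ e); exact: deg_cast_eq0.
Qed.

(** Maps out of a cone are free on the elements [(t, 0)], so lifts chosen there degree by degree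
    form a chain map. *)
Lemma cone_lift (B : int -> lmodType R) I X (q : chain_map I X) (F : chain_map (cone B) X) :
  (forall k, exists h : {linear B (k - 1) -> I k}, forall t, q k (h t) = F k (t, 0)) ->
  exists G : chain_map (cone B) I, forall k x, q k (G k x) = F k x.
Proof.
move=> /dep_choice[h hh]; have [G hG] := from_cone h; exists G => k x.
by rewrite -[LHS]/(cm_comp q G k x); apply: cone_eq => {x}k t /=; rewrite hG hh.
Qed.

Section Lifting.
Variables (K I X : chain_complex R) (i : chain_map K I) (q : chain_map I X).
Hypotheses (gK : forall n, GAC_injective_module (K n)).
Hypotheses (ii : cm_injective i) (sq : cm_surjective q) (eq : cm_exact_at i q).

Lemma GAC_cone_lift A (F : chain_map (cone A) X) : abs_clean_complex A ->
  exists G : chain_map (cone A) I, forall k x, q k (G k x) = F k x.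
Proof.
move=> cA; apply: cone_lift => k.
pose F' : {linear A (k - 1) -> X k} := F k \o @pair_inl R (A k) (A (k - 1)).
exact: (GAC_module_lift F' (gK k) (abs_clean_component (n := k - 1) cA) (@ii k) (@sq k) (@eq k)).
Qed.

Lemma GAC_null_homotopic_lift A (f : chain_map A X) :
  abs_clean_complex A -> null_homotopic f ->
  exists g : chain_map A I, forall k x, q k (g k x) = f k x.
Proof.
move=> cA /null_homotopicP[F hF]; have [G hG] := GAC_cone_lift F cA.
by exists (cm_comp G (cone_unit A)) => k x /=; rewrite hG hF.
Qed.

End Lifting.

Lemma to_cone_null_homotopic A (B : int -> lmodType R) (f : chain_map A (cone B)) :
  null_homotopic f.
Proof.
apply/null_homotopicP; exists (cone_map (fun k => snd \o f k)) => n x.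
by rewrite [RHS]to_coneP.
Qed.

Lemma null_homotopic_comp A X Y (f : chain_map A X) (g : chain_map X Y) (h : chain_map A Y) :
  null_homotopic f -> (forall n x, h n x = g n (f n x)) -> null_homotopic h.
Proof.
move=> /null_homotopicP[F hF] e; apply/null_homotopicP.
by exists (cm_comp g F) => n x; rewrite /= hF e.
Qed.

Definition abs_clean_null X : Prop :=
  forall A, abs_clean_complex A -> forall f : chain_map A X, null_homotopic f.

Lemma GAC_complex_null X : GAC_injective_complex X -> abs_clean_null X.
Proof.
case=> I [d [iI eI [i [ii ei]] hI]] A cA f; apply/null_homotopicP.
have [E hE] := iI 0 _ _ (cone_unit A) (cm_comp i f) (@cone_unit_inj _ A).
have [A' [p [cA' sp ep]]] := abs_clean_cosyzygy cA.
have [w hw] : exists w : chain_map A' (I (0 - 1)), forall n x, w n (p n x) = cm_comp (d 0) E n x.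
  apply: cm_factor_surj => // n x /ep[a <-]; rewrite /= hE.
  by apply/ei; exists (f n a).
have [h hh] : exists h : chain_map A' (I 0), forall n a, d 0 n (h n a) = w n a.
  apply/(hI A' cA' 0) => n a; case: (sp n a) => x <-.
  by rewrite hw; apply/(eI 0); exists (E n x).
(* The corrected map has values in the kernel of [d 0], that is in [X]; since [p] kills [A], it
   still restricts to [f]. *)
have [n x|g hg] := cm_lift_inj (f := cm_sub E (cm_comp h p)) ii.
  by apply/ei; rewrite /= linearB hh hw subrr.
exists g => n x; apply: ii; rewrite hg /= hE.
by rewrite (cm_exact_comp0 ep) linear0 subr0.
Qed.

(** Evaluate the resolution of [X] in degree [n]. Maps from [A] into it correspond to chain maps
    from a disc on [A], which is absolutely clean. *)
Lemma GAC_complex_component X n : GAC_injective_complex X -> GAC_injective_module (X n).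
Proof.
case=> I [d [iI eI [i [ii ei]] hI]].
pose J (k : int) : lmodType R := I k n.
have dJ k (x : J k) : d (k - 1) n (d k n x) = 0 by exact: cm_exact_comp0 (eI k) n x.
exists (@ChainComplex R J (fun k => d k n) dJ); split.
- by move=> k; exact: (injective_component (n := n) (iI k)).
- by move=> k; exact: (@eI k n).
- by exists (i n); split; [exact: (@ii n)|exact: (@ei n)].
move=> A cA k g; split=> [hg|[h hh] a]; last by rewrite -hh; exact: dJ.
have cD := abs_clean_disc (n := n - 1) cA.
have [G hG] := from_disc (g : {linear A -> I (k - 1) n}).
pose dG := cm_comp (d (k - 1)) G.
have [m x|h hh] := (hI _ cD k G).1.
  (* [cm_sub dG dG] acts as the zero map, with which [dG] is compared on the generating degree of
     the disc. *)
  rewrite -[LHS]/(dG m x) (disc_eq (g := cm_sub dG dG)) => [|a].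
    exact: subrr.
  have dG0 : dG n (conc_in (n - 1) A (n - 1) a, 0) = 0 by rewrite /= hG hg.
  by rewrite dG0 /= -[RHS]/(dG _ _ - dG _ _) subrr.
exists (h n \o @pair_inl _ _ _ \o conc_in (n - 1) A (n - 1)) => a.
by rewrite -hG; exact: hh.
Qed.

Definition ac_step K X : Prop :=
  exists I (i : chain_map K I) (q : chain_map I X),
    [/\ injective_complex I, cm_injective i, cm_surjective q & cm_exact_at i q].

Definition ac_good X : Prop :=
  (forall n, GAC_injective_module (X n)) /\ abs_clean_null X.

Lemma ac_good_right X : ac_good X -> exists2 Y, ac_good Y & ac_step X Y.
Proof.
case=> gX nX.
have /dep_choice[J /dep_choice[Z /dep_choice[i /dep_choice[p hip]]]] k := GAC_module_right (gX k).
have iJ k : injective_module (J k) by case: (hip k).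
have gZ k : GAC_injective_module (Z k) by case: (hip k).
have ii k : injective (i k) by case: (hip k).
have sp k : surj (p k) by case: (hip k).
have ep k : exact_at (i k) (p k) by case: (hip k).
(* Extending the differential of [X] to [J] straightens the graph of [X] in [cone J]: modulo [X],
   the pair [(t, b)] becomes [(t - e b, p b)]. This identifies the quotient degreewise. *)
have /dep_choice[e he] k : exists e : {linear J k -> J (k - 1)},
    forall x, e (i k x) = i (k - 1) (cc_d X k x).
  exact: (iJ (k - 1) _ _ (i k) (i (k - 1) \o cc_d X k) (ii k)).
pose Yo k : lmodType R := (J (k - 1) * Z k)%type.
have lpi k : linear (fun c : cone J k => (c.1 - e k c.2, p k c.2) : Yo k).
  move=> a x y; congr (_, _); rewrite /= !linearP //=.
  by rewrite scalerDr addrACA.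
pose pi k : {linear cone J k -> Yo k} := mklin (lpi k).
have spi k : surj (pi k).
  move=> [u z]; case: (sp k z) => b <-; exists (u + e k b, b).
  by rewrite /= addrK.
pose io := to_cone i.
have epi k : exact_at (io k) (pi k).
  move=> [t b]; split=> [h|[x <-]]; last first.
    by congr (_, _); rewrite /= ?he ?subrr //; apply/ep; exists x.
  case: h => /eqP.
  by rewrite subr_eq0 => /eqP -> /ep[x <-]; exists x; rewrite /= he.
have hd k c : pi k c = 0 -> pi (k - 1) (cc_d (cone J) k c) = 0.
  by case/epi=> x <-; apply/epi; exists (cc_d X k x); rewrite cm_comm.
have [dY [ddY [q hq]]] := quotient_complex_exists spi hd.
set Y := ChainComplex ddY in q hq.
have sq : cm_surjective q by move=> k y; case: (spi k y) => c <-; exists c; rewrite hq.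
have eq : cm_exact_at io q by move=> k c; rewrite hq; exact: epi.
have iio : cm_injective io by move=> k x y [_ /ii].
exists Y; last by exists (cone J), io, q; split=> //; exact: injective_cone.
split=> [k|A cA f].
  by apply: GAC_module_prod; first exact: GAC_module_injective.
(* The map [f r] on [cone S] lifts to [F] with values in [cone J], and [F] sends [S] into [X]. *)
have [S [r [cS sr er]]] := abs_clean_syzygy cA.
have [F hF] := GAC_cone_lift gX iio sq eq (cm_comp f r) cS.
have [n x|phi hphi] := cm_lift_inj (f := cm_comp F (cone_unit S)) iio.
  by apply/eq; rewrite /= hF /= (cm_exact_comp0 er) linear0.
(* Extending [phi] to [cone S] and subtracting makes the lift vanish on [S]; it descends to a lift
   [G] of [f] to the contractible [cone J]. *)
have /null_homotopicP[Psi hPsi] := nX S cS phi.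
have [n x|G hG] := cm_factor_surj (f := cm_sub F (cm_comp io Psi)) sr.
  by case/er=> y <-; rewrite -[LHS]/(F n _ - io n (Psi n _)) hPsi hphi subrr.
apply: (null_homotopic_comp (g := q) (to_cone_null_homotopic G)) => n x.
case: (sr n x) => y <-; rewrite hG -[X in q n X]/(F n y - io n (Psi n y)).
by rewrite linearB hF (cm_exact_comp0 eq) subr0.
Qed.

Lemma ac_good_left X : ac_good X -> exists2 K, ac_good K & ac_step K X.
Proof.
case=> gX nX.
(* The offset puts a cover of [X k] in [B (k - 1)], the first component of [cone B] in degree
   [k]. *)
have /dep_choice[B /dep_choice[N /dep_choice[i /dep_choice[p hip]]]] k :=
  GAC_module_left (gX (k + 1)).
have iB k : injective_module (B k) by case: (hip k).
have gN k : GAC_injective_module (N k) by case: (hip k).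
have ii k : injective (i k) by case: (hip k).
have e1 (k : int) : k - 1 + 1 = k by rewrite subrK.
pose p' k : {linear B (k - 1) -> X k} := deg_cast (e1 k) \o p (k - 1).
have sp k : surj (p' k).
  move=> x; have [_ _ _ sp _] := hip (k - 1).
  case: (sp (deg_cast (esym (e1 k)) x)) => t ht; exists t.
  by rewrite /= ht (deg_castK _ _ erefl).
have ep k : exact_at (i (k - 1)) (p' k).
  move=> t; have [_ _ _ _ ep] := hip (k - 1).
  by rewrite -(ep t); exact: deg_cast_eq0.
have [q hq] := from_cone p'.
(* Injective modules are absolutely clean, so the lifting property applies to [B k]. With [l], the
   value of [q] at [(t, b)] is [p' (t - l b)], whose kernel is a copy of [N (k - 1) * B k]. *)
have /dep_choice[l hl] k : exists l : {linear B k -> B (k - 1)},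
    forall b, p' k (l b) = - q k (0, b).
  exact: (GAC_module_lift (\- (q k \o linr (B (k - 1)) (B k))) (gN (k - 1))
    (abs_clean_injective (iB k)) (@ii (k - 1)) (@sp k) (@ep k)).
have qE k t b : q k (t, b) = p' k (t - l k b).
  rewrite linearB hl opprK -hq -(linearD (q k)); congr (q k (_, _)).
    by rewrite /= addr0.
  by rewrite /= add0r.
pose Ko k : lmodType R := (N (k - 1) * B k)%type.
have lj k : linear (fun x : Ko k => (i (k - 1) x.1 + l k x.2, x.2) : cone B k).
  move=> a x y; congr (_, _); rewrite /= !linearP /=.
  by rewrite scalerDr addrACA.
pose j k : {linear Ko k -> cone B k} := mklin (lj k).
have ij k : injective (j k) by move=> [z b] [z' b'] [] /[swap] -> /addIr/ii ->.
have ej k : exact_at (j k) (q k).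
  move=> [t b]; rewrite qE; split=> [/ep[z hz]|[[z b'] [<- <-]]].
    by exists (z, b); rewrite /= hz subrK.
  by rewrite addrK; apply/ep; exists z.
have hd k x : exists x', j (k - 1) x' = cc_d (cone B) k (j k x).
  apply/ej; rewrite cm_comm (_ : q k (j k x) = 0) ?linear0 //.
  by apply/ej; exists x.
have [dK [ddK [jc hj]]] := subcomplex_exists ij hd.
set K := ChainComplex ddK in jc hj.
have sq : cm_surjective q.
  by move=> k x; case: (sp k x) => t <-; exists (t, 0); rewrite hq.
have ijc : cm_injective jc by move=> k x y; rewrite !hj; exact: ij.
have ejc : cm_exact_at jc q.
  by move=> k y; rewrite (ej k y); split=> -[x hx]; exists x; rewrite -hx hj.
have gK k : GAC_injective_module (K k).
  by apply: GAC_module_prod; last exact: GAC_module_injective.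
exists K; last by exists (cone B), jc, q; split=> //; exact: injective_cone.
split=> // A cA f.
(* As [cone B] is contractible, [jc f] extends to [E] on [cone A]; modulo [K] this descends to [w]
   on the cosyzygy of [A]. *)
have /null_homotopicP[E hE] := to_cone_null_homotopic (cm_comp jc f).
have [A' [r [cA' sr er]]] := abs_clean_cosyzygy cA.
have [n x|w hw] := cm_factor_surj (f := cm_comp q E) sr.
  by case/er=> y <-; rewrite /= hE /= (cm_exact_comp0 ejc).
have [W hW] := GAC_null_homotopic_lift gK ijc sq ejc cA' (nX A' cA' w).
(* Subtracting the lift [W] of [w] brings [E] into [K] without changing it on [A], which [r]
   kills. *)
have [n x|g hg] := cm_lift_inj (f := cm_sub E (cm_comp W r)) ijc.
  by apply/ejc; rewrite -[X in q n X]/(E n x - W n (r n x)) linearB hW hw subrr.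
apply/null_homotopicP; exists g => n x; apply: ijc; rewrite hg.
rewrite -[LHS]/(E n _ - W n (r n _)) hE (cm_exact_comp0 er) linear0 subr0.
by [].
Qed.

End NullHomotopy.

(** * Splicing short exact sequences into a complete resolution *)

Section Splicing.
Variable R : pzRingType.
Implicit Types (A X Y K : chain_complex R).

Lemma ac_good_resolution X : ac_good X ->
  exists2 Z : int -> chain_complex R, Z 0 = X &
    (forall m, ac_good (Z m)) /\ (forall m, ac_step (Z m) (Z (m - 1))).
Proof.
move=> gX; pose G := {Y : chain_complex R | ac_good Y}.
have /dep_choice[r hr] (Y : G) : exists Y' : G, ac_step (sval Y) (sval Y').
  by case: (ac_good_right (svalP Y)) => Y' gY' sY; exists (exist _ Y' gY').
have /dep_choice[l hl] (Y : G) : exists Y' : G, ac_step (sval Y') (sval Y).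
  by case: (ac_good_left (svalP Y)) => Y' gY' sY; exists (exist _ Y' gY').
pose x0 : G := exist _ X gX.
(* Syzygies in positive degrees, cosyzygies in negative ones; [Negz n] is [- (n + 1)], hence [n.+1]
   iterations. *)
pose Z (m : int) : G := match m with Posz n => iter n l x0 | Negz n => iter n.+1 r x0 end.
exists (fun m => sval (Z m)) => //; split=> [m|[[|n]|n]]; first exact: svalP.
- exact: (hr x0).
- have -> : Posz n.+1 - 1 = Posz n by lia.
  exact: hl.
have -> : Negz n - 1 = Negz n.+1 by lia.
exact: hr.
Qed.

(** The spliced differential [i q] has the kernel of [q]. A cycle [A -> I (m - 1)] factors through
    [Z (m - 1)], is null homotopic there, and so lifts to [I m]. *)
Lemma ac_good_GAC X : ac_good X -> GAC_injective_complex X.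
Proof.
case/ac_good_resolution=> Z <- [gZ].
case/dep_choice=> I /dep_choice[i /dep_choice[q h]].
have iI m : injective_complex (I m) by case: (h m).
have ii m : cm_injective (i m) by case: (h m).
have sq m : cm_surjective (q m) by case: (h m).
have eq m : cm_exact_at (i m) (q m) by case: (h m).
pose d m : chain_map (I m) (I (m - 1)) := cm_comp (i (m - 1)) (q m).
have d0 m n x : d m n x = 0 <-> q m n x = 0.
  split=> [|e]; last by rewrite -[LHS]/(i _ n (q m n x)) e linear0.
  by rewrite -(linear0 (i (m - 1) n)) => /ii.
exists I, d; split=> // [m n y||A cA m g].
- rewrite d0 (eq (m - 1) n y); split=> -[x <-]; last by exists (q m n x).
  by case: (sq m n x) => z <-; exists z.
- exists (i 0); split=> // n x; rewrite d0; exact: eq.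
split=> [hg|[H hH] n a]; last first.
  by rewrite -hH d0; apply/eq; exists (q m n (H n a)).
have [n a|g' hg'] := cm_lift_inj (f := g) (ii (m - 1)).
  by apply/eq/d0/hg.
have [gK _] := gZ m; have [_ nX] := gZ (m - 1).
have [H hH] := GAC_null_homotopic_lift gK (ii m) (sq m) (eq m) cA (nX A cA g').
by exists H => n a; rewrite -hg' -hH.
Qed.

Lemma GAC_injective_complexP X : GAC_injective_complex X <-> ac_good X.
Proof.
split=> [gX|]; last exact: ac_good_GAC.
by split=> [n|]; [exact: GAC_complex_component|exact: GAC_complex_null].
Qed.

End Splicing.

(** * Exactness of the Hom complex and null homotopies *)

Section HomExact.
Variable R : pzRingType.
Implicit Types (A X : chain_complex R).

Lemma hom_dE A X n (f : hom_obj A X n) k x :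
  hom_d f k x = deg_cast (esym (addrA k n (- 1))) (cc_d X (k + n) (f k x))
    - neg_if (odd `|n|) (deg_cast (etrans (addrAC k (- 1) n) (esym (addrA k n (- 1))))
               (f (k - 1) (cc_d A k x))).
Proof.
rewrite /hom_d /= /hom_d_fun; congr (_ - _).
by rewrite -signr_odd scaler_sign /neg_if.
Qed.

(** Chain maps are the cycles of degree 0, written [1 - 1] to match the definition. In degree 1 the
    sign in the differential is positive, so a preimage is a null homotopy. *)
Lemma hom_exact_null A X : hom_complex_exact A X ->
  forall f : chain_map A X, null_homotopic f.
Proof.
move=> ex f; pose f' : hom_obj A X (1 - 1) := fun k => deg_cast (esym (addr0 k)) \o f k.
have [hf _] := ex 1 f'.
have [|g hg] := hf.
  move=> k x; rewrite hom_dE /= /neg_if /=.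
  rewrite cm_comm (cc_d_cast _ (congr1 (+%R^~ (- 1)) (esym (addr0 k)))).
  have e : k - 1 = k + (1 - 1 - 1) by lia.
  apply/eqP; rewrite subr_eq0; apply/eqP.
  by rewrite (deg_castK _ _ e) (deg_castK _ _ e).
have e1 (k : int) : k - 1 + 1 = k by rewrite subrK.
exists (fun n => deg_cast (e1 n) \o g (n - 1)) => n x /=.
have := hg (n - 1) x; rewrite hom_dE /= /neg_if /= opprK /f' /=.
move/(congr1 (deg_cast (addr0 (n - 1)))).
rewrite (deg_castK _ _ erefl) deg_cast_id => <-.
rewrite linearD /=; congr (_ + _).
  by rewrite (cc_d_cast _ (congr1 (+%R^~ (- 1)) (e1 n))); exact: deg_castK.
exact: deg_castK.
Qed.

(** A cycle of degree [m = n - 1] is a chain map to [X] from a shift of [A] whose differential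
    carries the sign of [m]. This shift is absolutely clean, and a null homotopy of the map is a
    preimage of the cycle. *)
Lemma null_hom_exact A X : abs_clean_complex A -> abs_clean_null X -> hom_complex_exact A X.
Proof.
move=> cA nX n f; split=> [hf|[g hg] k x]; last first.
  by rewrite -[RHS](hom_dd g x) (hom_dE f) (hom_dE (hom_d g)) !hg.
pose m := n - 1; pose b := odd `|m|.
have e1 (k : int) : k - m + m = k by rewrite subrK.
pose F k : {linear shift (- m) b A k -> X k} := deg_cast (e1 k) \o f (k - m).
have cF k x : F (k - 1) (cc_d (shift (- m) b A) k x) = cc_d X k (F k x).
  rewrite shift_dE /F [LHS]/= [in RHS]/=.
  have /eqP := hf (k - m) x; rewrite hom_dE subr_eq0 => /eqP.
  move/(congr1 (deg_cast (addrA (k - m) m (- 1)))); rewrite (deg_castK _ _ erefl) deg_cast_id.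
  rewrite (cc_d_cast _ (congr1 (+%R^~ (- 1)) (e1 k))) => ->.
  rewrite linear_neg_if !deg_cast_neg_if; congr neg_if.
  rewrite (deg_cast_nat (Z := fun k => X (k + m)) f).
  have e2 : k - m - 1 + m = k - 1 - m + m by lia.
  have e3 : k - m - 1 + m = k - 1 by lia.
  have e4 : k - m - 1 + m = k - m + m - 1 by lia.
  by rewrite (deg_cast_shift _ e2) (deg_castK _ _ e3) (deg_castK _ _ e4) (deg_castK _ _ e3).
have [s hs] := nX _ (abs_clean_shift (n := - m) (b := b) cA) (ChainMap cF).
(* The source of [s (k + n)] is the shift of [A] in degree [k + n - 1], which is [A k]. *)
have e2 (k : int) : k = k + n - 1 - m by rewrite /m; lia.
pose g k : {linear A k -> X (k + n)} := s (k + n) \o deg_cast (e2 k).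
have gE k x : g k x = s (k + n) (deg_cast (e2 k) x) by [].
exists g => k x; rewrite hom_dE !gE.
have := hs (k + n) (deg_cast (e2 k) x).
rewrite -[LHS]/(F _ _) => /eqP; rewrite -subr_eq => /eqP <-.
(* The opposite parities of [n] and [m] turn the difference in the Hom differential into the sum
   required by a homotopy. *)
have -> : odd `|n| = ~~ b by rewrite /b /m; lia.
rewrite neg_ifN opprK deg_castB shift_dE linear_neg_if deg_cast_neg_if.
rewrite /F [X in deg_cast _ X - _]/= (deg_cast_nat (Z := fun k => X (k + m)) f).
have e4 : k + m = k + n - 1 - m + m by rewrite /m; lia.
have e5 : k + m = k + n - 1 by rewrite /m; lia.
have e6 : k - 1 + n = k + n - 1 by lia.
have e8 : k - 1 + n - 1 - m = k + n - 1 - 1 - m by lia.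
have e9 : k - 1 = k + n - 1 - 1 - m by rewrite /m; lia.
rewrite (deg_cast_shift _ e4) (deg_castK _ _ e5) (deg_castK _ _ erefl) deg_cast_id.
have -> : s (k + n - 1) (deg_cast (addrAC (k + n - 1) (- m) (- 1))
    (cc_d A (k + n - 1 - m) (deg_cast (e2 k) x)))
  = deg_cast (Y := X) e6 (s (k - 1 + n) (deg_cast (e2 (k - 1)) (cc_d A k x))).
  rewrite -(deg_cast_nat (Y := fun k => A (k - 1 - m)) (Z := X) s); congr (s _ _).
  rewrite (cc_d_cast _ (congr1 (+%R^~ (- 1)) (e2 k))) (deg_castK _ _ e9).
  rewrite (deg_cast_reindex (h := fun k => k - 1 - m) _ e8).
  by rewrite (deg_castK _ _ e9).
rewrite (deg_castK _ _ (etrans (addrAC k (- 1) n) (esym (addrA k n (- 1))))).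
by rewrite subrK.
Qed.

End HomExact.

Theorem theorem3p2 (R : pzRingType) (X : chain_complex R) :
  (GAC_injective_complex X <->
     (forall n : int, GAC_injective_module (X n)) /\
     (forall A : chain_complex R, abs_clean_complex A -> hom_complex_exact A X))
  /\
  (GAC_injective_complex X <->
     (forall n : int, GAC_injective_module (X n)) /\
     (forall A : chain_complex R, abs_clean_complex A ->
        forall f : chain_map A X, null_homotopic f)).
Proof.
split; last exact: GAC_injective_complexP.
apply: (iff_trans (GAC_injective_complexP X)); split=> -[gX hX]; split=> // A cA.
  exact: null_hom_exact.
by apply: hom_exact_null; exact: hX.
Qed.
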